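(* (Graph-style geometry ODE for invariant cones of homogeneous piecewise linear mechanical systems.) Consider the two-zone homogeneous piecewise linear mechanical system described in the context, written as $\dot x_i=y_i$, $\dot y_i=f_i(p)$, $i=1,\dots,N$, with state $p=(x_1,y_1,\dots,x_N,y_N)$. Let $\mathcal C\subset\mathbb R^{2N}$ be an invariant cone of this system. Fix a master index $m$, write $(x_m,y_m)=(u,v)=r(\cos\theta,\sin\theta)$ with $r=\sqrt{u^2+v^2}>0$, let $\mathcal H_{\rm cyl}=\{p\in\mathbb R^{2N}: u^2+v^2=1\}$, and let $\mathcal G=\mathcal C\cap\mathcal H_{\rm cyl}$ be the generating set. Assume that the map sending each ray of $\mathcal C$ to its intersection with $\mathcal H_{\rm cyl}$ is a well-defined bijection from the set of rays of $\mathcal C$ onto $\mathcal G$, and that $\mathcal G$ is a single-valued function $\mathcal G(\theta)$ of the angle $\theta$. Then $\mathcal C$ is parametrized by $(r,\theta)\in[0,\infty)\times S^1\mapsto p=r\,\mathcal G(\theta)$, where $\mathcal G(\theta)$ is the state with $x_m=\cos\theta$, $y_m=\sin\theta$ and $x_j=P_j(\theta)$, $y_j=Q_j(\theta)$ for $j\neq m$; that is, on $\mathcal C$ the remaining variables satisfy $x_j=rP_j(\theta)$, $y_j=rQ_j(\theta)$ for all $j\ne m$. The dynamics of the master pair on $\mathcal C$ is $$\frac{\dot r}{r}=\tilde R(\theta):=\sin\theta\cos\theta+\sin\theta\, f_m(\mathcal G(\theta)),\qquad \dot\theta=\tilde\Theta(\theta):=-\sin^2\theta+\cos\theta\, f_m(\mathcal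 G(\theta)),$$ and invariance of $\mathcal C$ reduces to the system of ordinary differential equations $$P_j'(\theta)=\frac{Q_j(\theta)-\tilde R(\theta)P_j(\theta)}{\tilde\Theta(\theta)},\qquad Q_j'(\theta)=\frac{f_j(\mathcal G(\theta))-\tilde R(\theta)Q_j(\theta)}{\tilde\Theta(\theta)},\qquad \text{for all } j\ne m,$$ (wherever $\tilde\Theta(\theta)\neq0$; the equations are singular where $\dot\theta=\tilde\Theta=0$), together with the periodic boundary conditions $P_j(0)=P_j(2\pi)$ and $Q_j(0)=Q_j(2\pi)$.
   Context: The system: let $M,C,K\in\mathbb R^{N\times N}$ be symmetric with $M$ and $K$ positive definite, let $w\in\mathbb R^N$ be constant, $k_n>0$ and $c_n>0$ (or $c_n=0$ as the continuous special case). For $(q,\dot q)\in\mathbb R^{2N}$ put $h_\alpha=w^\top q$ and $h_\beta=k_n w^\top q+c_n w^\top\dot q$. The equations of motion are $M\ddot q+(C+c_nww^\top)\dot q+(K+k_nww^\top)q=0$ in the contact region $\{h_\alpha>0 \text{ and } h_\beta>0\}$ and $M\ddot q+C\dot q+Kq=0$ in the no-contact region $\{h_\alpha<0\text{ or }h_\beta<0\}$, solutions being understood in the sense of Filippov on the switching boundary. Write $x_i=q_i$, $y_i=\dot q_i$, and let $f_i$ be the resulting piecewise linear expression for $\ddot q_i$. The vector field is positively homogeneous of degree one: $f_i(\beta p)=\beta f_i(p)$ for all $\beta>0$. An invariant cone is a set, invariant under the flow, that consists of the origin and a collection of rays $\{\alpha p:\alpha>0\}$ with $p\neq0$, and that is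 generated by the flow from a ray on the switching boundary which returns to itself. A dot denotes the time derivative, and a prime on $P_j,Q_j$ the derivative with respect to $\theta$. *)

(* Defs.v *)
From HB Require Import structures.
From mathcomp Require Import all_boot all_order all_algebra.
From mathcomp Require Import all_classical all_reals all_analysis.

Set Implicit Arguments.
Unset Strict Implicit.
Unset Printing Implicit Defensive.

Import Order.TTheory GRing.Theory Num.Theory.
Import numFieldNormedType.Exports.

Local Open Scope classical_set_scope.
Local Open Scope ring_scope.

(* A state p is the pair (x, y) = (q, q') of columns of R^N. *)
Notation state R N := ('cV[R]_N * 'cV[R]_N)%type.

Definition symmetric_mx (R : realType) (N : nat) (A : 'M[R]_N) : Prop :=
  A^T = A.

Definition posdef_mx (R : realType) (N : nat) (A : 'M[R]_N) : Prop :=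
  forall z : 'cV[R]_N, z != 0 -> 0 < (z^T *m A *m z) 0 0.

Record mech (R : realType) (N : nat) := Mech {
  massM : 'M[R]_N;
  dampC : 'M[R]_N;
  stiffK : 'M[R]_N;
  wvec : 'cV[R]_N;
  kn : R;
  cn : R
}.

Definition admissible (R : realType) (N : nat) (S : mech R N) : Prop :=
  [/\ symmetric_mx (massM S), symmetric_mx (dampC S) & symmetric_mx (stiffK S)]
  /\ [/\ posdef_mx (massM S), posdef_mx (stiffK S), 0 < kn S & 0 <= cn S].

Section TwoZoneSystem.
Variables (R : realType) (N : nat) (S : mech R N).
Implicit Types (p : state R N).

Definition h_alpha p : R := ((wvec S)^T *m p.1) 0 0.

Definition h_beta p : R :=
  kn S * ((wvec S)^T *m p.1) 0 0 + cn S * ((wvec S)^T *m p.2) 0 0.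

Definition in_contact p : bool := (0 < h_alpha p) && (0 < h_beta p).

Definition no_contact p : bool := (h_alpha p < 0) || (h_beta p < 0).

Definition switching_boundary : set (state R N) :=
  [set p : state R N | ~~ in_contact p /\ ~~ no_contact p].

(* The two equations of motion solved for q''. *)
Definition acc_contact p : 'cV[R]_N :=
  - (invmx (massM S) *m
      ((dampC S + cn S *: (wvec S *m (wvec S)^T)) *m p.2
       + (stiffK S + kn S *: (wvec S *m (wvec S)^T)) *m p.1)).

Definition acc_free p : 'cV[R]_N :=
  - (invmx (massM S) *m (dampC S *m p.2 + stiffK S *m p.1)).

(* The piecewise linear f = (f_1, ..., f_N).  On the switching boundary the two
   expressions differ by M^-1 w h_beta, so the value chosen there matters only
   on [crossing_set] below. *)
Definition accel p : 'cV[R]_N :=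
  if in_contact p then acc_contact p else acc_free p.

(* The part of the switching boundary on which h_beta <> 0.  There the time
   derivative of h_alpha is w^T y = h_beta / c_n > 0 (and c_n = 0 is
   impossible), so every solution crosses from no contact into contact. *)
Definition crossing_set : set (state R N) :=
  [set p : state R N | h_alpha p = 0 /\ 0 < h_beta p].

(* Filippov's convex regularization: on the switching boundary, the segment
   joining the limits of f from the two zones. *)
Definition filippov p : set 'cV[R]_N :=
  [set a | [/\ in_contact p -> a = acc_contact p,
               no_contact p -> a = acc_free p &
               switching_boundary p -> exists l : R,
                 [/\ 0 <= l, l <= 1 &
                     a = (1 - l) *: acc_free p + l *: acc_contact p]]].

End TwoZoneSystem.

Definition absolutely_continuous (R : realType) (a b : R) (g : R -> R) : Prop :=
  forall e : R, 0 < e -> exists2 d : R, 0 < d &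
    forall (n : nat) (u v : 'I_n -> R),
      (forall i, [/\ a <= u i, u i <= v i & v i <= b]) ->
      (forall i j, i != j -> v i <= u j \/ v j <= u i) ->
      \sum_(i < n) (v i - u i) < d ->
      \sum_(i < n) `|g (v i) - g (u i)| < e.

(* Filippov solution on [a, b]. *)
Definition is_solution (R : realType) (N : nat) (S : mech R N)
    (a b : R) (phi : R -> state R N) : Prop :=
  (forall i : 'I_N,
     absolutely_continuous a b (fun t => (phi t).1 i 0) /\
     absolutely_continuous a b (fun t => (phi t).2 i 0)) /\
  {ae (@lebesgue_measure R), forall t : R, a < t < b ->
     exists2 acc : 'cV[R]_N, filippov S (phi t) acc &
       forall i : 'I_N,
         is_derive t (1 : R) (fun s => (phi s).1 i 0) ((phi t).2 i 0) /\
         is_derive t (1 : R) (fun s => (phi s).2 i 0) (acc i 0)}.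

Section Cones.
Variables (R : realType) (N : nat).
Implicit Types (p : state R N) (C : set (state R N)).

Definition ray p : set (state R N) := [set al *: p | al in [set al : R | 0 < al]].

Definition rays C : set (set (state R N)) :=
  [set ray p | p in [set p : state R N | C p /\ p <> 0]].

Definition flow_invariant (S : mech R N) C : Prop :=
  forall (a b : R) (phi : R -> state R N), a <= b ->
    is_solution S a b phi -> C (phi a) ->
    forall t : R, a <= t <= b -> C (phi t).

Definition generated_by_returning_ray (S : mech R N) C : Prop :=
  exists (phi : R -> state R N) (T : R),
    [/\ 0 < T, is_solution S 0 T phi,
        switching_boundary S (phi 0) /\ phi 0 <> 0,
        ray (phi 0) (phi T) &
        C = [set 0] `|` \bigcup_(t in `[0, T]) ray (phi t)].

Definition invariant_cone (S : mech R N) C : Prop :=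
  [/\ C = [set 0] `|` \bigcup_(rho in rays C) rho,
      flow_invariant S C &
      generated_by_returning_ray S C].

Definition H_cyl (m : 'I_N) : set (state R N) :=
  [set p : state R N | p.1 m 0 ^+ 2 + p.2 m 0 ^+ 2 = 1].

Definition generating_set (m : 'I_N) C : set (state R N) := C `&` H_cyl m.

Definition rays_biject_generating_set (m : 'I_N) C : Prop :=
  exists g : set (state R N) -> state R N,
    (forall rho, rays C rho -> rho `&` H_cyl m = [set g rho]) /\
    set_bij (rays C) (generating_set m C) g.

(* The generating set is the graph of a function on the whole circle. *)
Definition single_valued_in_angle (m : 'I_N) C : Prop :=
  forall theta : R, exists! p : state R N,
    [/\ generating_set m C p, p.1 m 0 = cos theta & p.2 m 0 = sin theta].

Definition graph_state (m : 'I_N) (P Q : 'I_N -> R -> R) (theta : R) :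
    state R N :=
  (\col_i (if i == m then cos theta else P i theta),
   \col_i (if i == m then sin theta else Q i theta)).

(* In the next definitions f is the acceleration field and G the map
   theta |-> G(theta). *)
Definition Rtilde (m : 'I_N) (f : state R N -> 'cV[R]_N)
    (G : R -> state R N) (theta : R) : R :=
  sin theta * cos theta + sin theta * f (G theta) m 0.

Definition Thetatilde (m : 'I_N) (f : state R N -> 'cV[R]_N)
    (G : R -> state R N) (theta : R) : R :=
  - sin theta ^+ 2 + cos theta * f (G theta) m 0.

Definition has_derivative (g : R -> R) (t d : R) : Prop :=
  is_derive t (1 : R) g d.

Definition has_left_derivative (g : R -> R) (t d : R) : Prop :=
  h^-1 * (g (t + h) - g t) @[h --> (0 : R)^'-] --> d.

Definition has_right_derivative (g : R -> R) (t d : R) : Prop :=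
  h^-1 * (g (t + h) - g t) @[h --> (0 : R)^'+] --> d.

(* D is one of the three notions of derivative above. *)
Definition master_ode (D : (R -> R) -> R -> R -> Prop) (m : 'I_N)
    (f : state R N -> 'cV[R]_N) (G : R -> state R N)
    (r theta : R -> R) (t : R) : Prop :=
  (exists2 rdot : R, D r t rdot & rdot / r t = Rtilde m f G (theta t)) /\
  D theta t (Thetatilde m f G (theta t)).

Definition geometry_ode (D : (R -> R) -> R -> R -> Prop) (m : 'I_N)
    (f : state R N -> 'cV[R]_N) (P Q : 'I_N -> R -> R) (theta : R) : Prop :=
  let G := graph_state m P Q in
  forall j : 'I_N, j != m ->
    D (P j) theta
      ((Q j theta - Rtilde m f G theta * P j theta) / Thetatilde m f G theta) /\
    D (Q j) theta
      ((f (G theta) j 0 - Rtilde m f G theta * Q j theta)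
        / Thetatilde m f G theta).

End Cones.

(* Main.v *)
Require Import Defs.
From HB Require Import structures.
From mathcomp Require Import all_boot all_order all_algebra.
From mathcomp Require Import all_classical all_reals all_analysis.
From mathcomp Require Import ring lra.
Import Order.TTheory GRing.Theory Num.Theory.
Import numFieldNormedType.Exports.
Local Open Scope classical_set_scope.
Local Open Scope ring_scope.

Set Implicit Arguments.
Unset Strict Implicit.
Unset Printing Implicit Defensive.

(* A cone ray is met once by the cylinder, so G(theta) is obtained by choice and
   every state of C is r G(theta).  Solutions are only Filippov solutions, but
   along each of them the admissible accelerations have a limit on either side
   of every instant: off the crossing set the set-valued field is single-valued
   and continuous at the point (the two expressions agree where h_beta = 0), and
   on it h_alpha is strictly increasing in time, which selects the zone before
   and after.  An absolutely continuous function whose derivative tends to c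
   almost everywhere on one side has the one-sided derivative c, hence the master
   equations hold one-sidedly everywhere.
   For the equations of P and Q, each ray of C carries a piece of the generating
   solution on both sides of it (its end points lie on the same ray).  On such a
   piece theta' <> 0 at one instant suffices: by the intermediate value theorem
   theta covers a one-sided neighbourhood of its value, and the one-sided
   derivative of P_j is the quotient of those of x_j / r and theta. *)

(** * Absolutely continuous functions *)

(** The partition built below grows by prepending intervals, which suits lists better than families
    over ['I_n]; the head is the rightmost interval, hence the order in [pairwise]. *)
Lemma absolutely_continuous_seq (R : realType) (a b : R) (g : R -> R) :
  absolutely_continuous a b g ->
  forall e : R, 0 < e -> exists2 d : R, 0 < d &
    forall s : seq (R * R),
      all (fun I => [&& a <= I.1, I.1 <= I.2 & I.2 <= b]) s ->
      pairwise (fun I J : R * R => J.2 <= I.1) s ->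
      \sum_(I <- s) (I.2 - I.1) < d ->
      \sum_(I <- s) `|g I.2 - g I.1| < e.
Proof.
move=> acg e e0; have [d d0 dP] := acg e e0; exists d => // s /all_nthP sab.
move=> /(pairwiseP (0, 0)) sP.
rewrite !(big_nth (0, 0)) !big_mkord => sd.
apply: (dP _ (fun i : 'I_(size s) => (nth (0, 0) s i).1)
             (fun i : 'I_(size s) => (nth (0, 0) s i).2)) => //.
  by move=> i; have /and3P[] := sab (0, 0) i (ltn_ord i).
move=> i j ij; have [ltij|ltji|eqij] := ltngtP i j.
- by right; apply: sP => //; rewrite inE.
- by left; apply: sP => //; rewrite inE.
- by move/val_inj: eqij => eqij; rewrite eqij eqxx in ij.
Qed.

(** At the supremum of the points of [[a, b]] where [P] holds, the step jumps from a point just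
    before it to one just after it, so the supremum is [b]. This is Cousin's lemma in inductive
    form. *)
Lemma real_induction (R : realType) (a b : R) (P : R -> Prop) :
  a <= b -> P a ->
  (forall s, a <= s <= b -> exists2 d, 0 < d &
     forall y z, s - d < y -> y <= s -> s <= z -> z < s + d ->
       a <= y -> z <= b -> P y -> P z) ->
  P b.
Proof.
move=> ab Pa step.
pose E := [set x | a <= x <= b /\ P x].
have Ea : E a by split; rewrite // lexx ab.
have supE : has_sup E.
  by split; [exists a | exists b => x [/andP[]]].
have sab : a <= sup E <= b.
  apply/andP; split; first exact: ub_le_sup supE.2 _ Ea.
  by apply: ge_sup; [exists a | move=> x [/andP[]]].
have [d d0 dP] := step _ sab.
have [y [/andP[ay yb] Py] yd] := sup_adherent d0 supE.
have ys : y <= sup E by apply: ub_le_sup supE.2 _ _; split; rewrite // ay yb.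
have [sb|bs] := ltP (sup E) b; last first.
  have sE : sup E = b by apply/eqP; rewrite eq_le bs; case/andP: sab => _ ->.
  apply: (dP y) => //; [by rewrite sE | by rewrite sE; lra].
(* Beyond the supremum, within reach of the step and still in [[a, b]]. *)
pose z := Num.min b (sup E + d / 2).
have sz : sup E < z by rewrite /z lt_min sb /= ; lra.
have zb : z <= b by rewrite /z ge_min lexx.
have zd : z < sup E + d.
  by apply: (@le_lt_trans _ _ (sup E + d / 2)); [rewrite /z ge_min lexx orbT | lra].
have Pz : P z by apply: (dP y) => //; exact: ltW.
have : z <= sup E.
  apply: ub_le_sup supE.2 _ _; split => //.
  by rewrite zb andbT (le_trans ay) // (le_trans ys) // ltW.
by rewrite leNgt sz.
Qed.

(** The Caratheodory slope is continuous at [s] with value [d], so it exceeds [- e] on both sides;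
    the increments over [[y, s]] and [[s, z]] then add up. *)
Lemma is_derive_ge0_straddle (R : realType) (g : R -> R) (s d e : R) :
  is_derive s (1 : R) g d -> 0 <= d -> 0 < e ->
  exists2 dl, 0 < dl & forall y z, s - dl < y -> y <= s -> s <= z ->
    z < s + dl -> - e * (z - y) <= g z - g y.
Proof.
move=> /is_derive1_caratheodory[k [kE kc kd]] d0 e0.
have : \forall x \near s, - e < k x.
  by apply: (cvgr_gt (k s) kc); rewrite kd; lra.
move=> /nbhs_ballP[dl /= dl0 dlP]; exists dl => // y z ys1 ys2 sz1 sz2.
have ky : - e < k y by apply: dlP; rewrite /ball/= ger0_norm; lra.
have kz : - e < k z by apply: dlP; rewrite /ball/= ler0_norm; lra.
have -> : g z - g y = k z * (z - s) + k y * (s - y).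
  by have := kE z; have := kE y; lra.
have -> : - e * (z - y) = - e * (z - s) + - e * (s - y) by ring.
by apply: lerD; apply: ler_wpM2r; lra.
Qed.

(* Points of the exceptional null set are tagged by intervals inside an open
   set of small measure, all others by intervals on which the slope is almost
   nonnegative; real induction builds a finite partition of both kinds. *)
Lemma ac_ae_derive_ge0 (R : realType) (a b : R) (g : R -> R) :
  a <= b -> absolutely_continuous a b g ->
  {ae (@lebesgue_measure R), forall t : R, a < t < b ->
     exists2 d, 0 <= d & is_derive t (1 : R) g d} ->
  g a <= g b.
Proof.
move=> ab acg aeP.
set mu := @lebesgue_measure R in aeP *.
(* The end points join the null set because nothing is assumed about the derivative there. *)
have [A [mA A0 AP]] : mu.-negligible
    (~` [set t | a < t < b -> exists2 d, 0 <= d & is_derive t (1 : R) g d]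
     `|` ([set a] `|` [set b])).
  by apply: negligibleU => //; apply: negligibleU;
    apply/negligibleP => //; exact: lebesgue_measure_set1.
(* Here [e] is both the slope tolerance and the bound on the variation over the tagged intervals;
   dividing by [b - a + 1] recovers any given bound. *)
suff H e : 0 < e -> g a - g b <= e * (b - a) + e.
  rewrite -subr_le0; apply/ler_addgt0Pr => e e0; rewrite add0r.
  have c0 : 0 < b - a + 1 by lra.
  have e1 : 0 < e / (b - a + 1) by apply: divr_gt0.
  apply: le_trans (H _ e1) _.
  rewrite -[X in _ + X]mulr1 -mulrDr divfK ?gt_eqF//.
move=> e0; have [dl dl0 dlP] := absolutely_continuous_seq acg e0.
have [U [oU AU Udl]] : exists U : set R, [/\ open U, A `<=` U &
    (mu (U `\` A) < dl%:E)%E].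
  by apply: lebesgue_regularity_outer => //; rewrite [X in (X < _)%E]A0.
have mU : measurable U by apply: measurable_realfun.open_measurable.
have {}Udl : (mu U < dl%:E)%E.
  apply: le_lt_trans Udl; rewrite -[leRHS]add0e -[X in (_ <= X + _)%E]A0.
  apply: le_trans (measureU2 _ _ _) => //; last exact: measurableD.
  apply: le_measure; rewrite ?inE//; first by apply: measurableU => //; exact: measurableD.
  by move=> x Ux; have [Ax|Ax] := pselect (A x); [left|right].
(* Only intervals tagged in [A] are listed. Their length is charged to the part of [U] left of [x];
   elsewhere the drop of [g] is charged to the slope [e]. *)
pose fine x (s : seq (R * R)) :=
  [/\ all (fun I => [&& a <= I.1, I.1 <= I.2 & I.2 <= x]) s,
      pairwise (fun I J : R * R => J.2 <= I.1) s,
      ((\sum_(I <- s) (I.2 - I.1))%:E <= mu (U `&` `[a, x[))%E &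
      g a - g x <= e * (x - a) + \sum_(I <- s) `|g I.2 - g I.1|].
have [s [s1 s2 s3 s4]] : exists s, fine b s.
  apply: (@real_induction _ a b (fun x => exists s, fine x s)) => //.
    by exists [::]; split; rewrite // big_nil ?measure_ge0// !subrr mulr0 addr0.
  (* For [s] in [A] the interval [[y, z]] lies in [U] and is added to the list. *)
  move=> s /andP[as_ sb]; have [As|As] := pselect (A s).
    have /nbhs_ballP[d /= d0 dU] : nbhs s U.
      by apply: open_nbhs_nbhs; split => //; exact: AU.
    exists d => // y z ys1 ys2 sz1 sz2 ay zb [l [l1 l2 l3 l4]].
    exists ((y, z) :: l); split => /=.
    - rewrite ay lexx (le_trans ys2 sz1) /=.
      apply/allP => I /(allP l1) /and3P[-> -> Iy] /=.
      by rewrite (le_trans Iy) // (le_trans ys2).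
    - by rewrite l2 andbT; apply/allP => I /(allP l1) /and3P[].
    - rewrite big_cons /= addrC.
      have UE : U `&` `[a, z[ = (U `&` `[a, y[) `|` `[y, z[.
        apply/seteqP; split => x /=; rewrite !in_itv /=.
          move=> [Ux /andP[ax xz]]; have [xy|yx] := ltP x y.
            by left; rewrite ax.
          by right.
        move=> [[Ux /andP[ax xy]]|/andP[yx xz]].
          split => //; rewrite ax /=; lra.
        split; last by rewrite xz andbT (le_trans ay).
        apply: dU; rewrite /ball /= ltr_norml; lra.
      rewrite UE /mu measureU//.
      + rewrite EFinD leeD// [X in (_ <= X)%E]lebesgue_measure_itv /= lte_fin.
        have : y <= z by lra.
        by rewrite le_eqVlt => /orP[/eqP->|->]; rewrite ?subrr ?ltxx.
      + exact: measurableI.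
      + apply/seteqP; split => x //=; rewrite !in_itv/= => -[[_ /andP[_ xy]] /andP[yx _]].
        by have := lt_le_trans xy yx; rewrite ltxx.
    - rewrite big_cons /=; have := ler_norm (g y - g z); rewrite distrC => ?.
      have : e * (y - a) <= e * (z - a) by apply: ler_wpM2l; lra.
      lra.
  (* Outside [A] the list is kept, and the straddle estimate bounds the drop from [y] to [z] by
     [e * (z - y)]. *)
  have [d d0 gs] : exists2 d, 0 <= d & is_derive s (1 : R) g d.
    apply: contrapT => nd; apply: As; apply: AP.
    have [asb|] := boolP (a < s < b); first by left => /= /(_ asb).
    rewrite negb_and -!leNgt => /orP[sa|bs]; right.
      by left => /=; apply/eqP; rewrite eq_le sa.
    by right => /=; apply/eqP; rewrite eq_le sb.
  have [dl' dl'0 dlg] := is_derive_ge0_straddle gs d0 e0.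
  exists dl' => // y z ys1 ys2 sz1 sz2 ay zb [l [l1 l2 l3 l4]].
  exists l; split => //.
  - apply/allP => I /(allP l1) /and3P[-> -> Iy] /=.
    by rewrite (le_trans Iy) // (le_trans ys2).
  - apply: le_trans l3 _; apply: le_measure; rewrite ?inE; [exact: measurableI..|].
    move=> x /= [Ux]; rewrite !in_itv /= => /andP[-> xy]; split => //=.
    lra.
  - have := dlg _ _ ys1 ys2 sz1 sz2.
    have -> : e * (z - a) = e * (y - a) + e * (z - y) by ring.
    lra.
(* The listed intervals have total length below [dl], so absolute continuity bounds their variation
   by [e]. *)
apply: le_trans s4 _; rewrite lerD2l ltW//; apply: dlP => //.
rewrite -lte_fin; apply: le_lt_trans s3 _; apply: le_lt_trans Udl.
by apply: le_measure; rewrite ?inE//; exact: measurableI.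
Qed.

(** * One-sided derivatives *)

(* The right derivative for e = 1 and the left derivative for e = -1. *)
Definition sided_derivative (R : realType) (e : R) (g : R -> R) (t d : R) :=
  (e * h)^-1 * (g (t + e * h) - g t) @[h --> (0 : R)^'+] --> d.

(** Caratheodory form: a slope factor with a limit replaces the quotient, so the product and chain
    rules become limits of products. *)
Lemma sided_derivativeP (R : realType) (e : R) (g : R -> R) (t d : R) :
  e != 0 -> sided_derivative e g t d <->
  exists2 k : R -> R,
    (\forall h \near (0 : R)^'+, g (t + e * h) - g t = k h * (e * h)) &
    k h @[h --> (0 : R)^'+] --> d.
Proof.
move=> e0; split=> [sd|[k kE kd]].
  exists (fun h => (e * h)^-1 * (g (t + e * h) - g t)) => //.
  near=> h.
  have h0 : h != 0 by rewrite gt_eqF//; near: h; exact: nbhs_right_gt.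
  by rewrite mulrAC mulVf ?mul1r// mulf_neq0.
apply: cvg_trans kd; apply: near_eq_cvg; near=> h.
have -> : g (t + e * h) - g t = k h * (e * h) by near: h.
have h0 : h != 0 by rewrite gt_eqF//; near: h; exact: nbhs_right_gt.
by rewrite mulrC mulfK// mulf_neq0.
Unshelve. all: by end_near. Qed.

Lemma cvg_at_right_cst0 (R : realType) (e : R) :
  e * h @[h --> (0 : R)^'+] --> (0 : R).
Proof.
rewrite -[X in _ --> X](mulr0 e); apply: cvgMr.
exact: cvg_at_right_filter.
Qed.

Lemma cvg_at_right_affine (R : realType) (e t : R) :
  t + e * h @[h --> (0 : R)^'+] --> t.
Proof.
rewrite -[X in _ --> X]addr0; apply: cvgD; first exact: cvg_cst.
exact: cvg_at_right_cst0.
Qed.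

Lemma sided_derivative_cvg (R : realType) (e : R) (g : R -> R) (t d : R) :
  e != 0 -> sided_derivative e g t d ->
  g (t + e * h) @[h --> (0 : R)^'+] --> g t.
Proof.
move=> e0 /(sided_derivativeP _ _ _ e0)[k kE kd].
rewrite -[X in _ --> X]addr0 -[X in _ + X](mulr0 d).
have : (g t + k h * (e * h)) @[h --> (0 : R)^'+] --> g t + d * 0.
  apply: cvgD; first exact: cvg_cst.
  by apply: cvgM => //; exact: cvg_at_right_cst0.
apply: cvg_trans; apply: near_eq_cvg; near=> h.
have <- : g (t + e * h) - g t = k h * (e * h) by near: h.
by rewrite addrC subrK.
Unshelve. all: by end_near. Qed.

Lemma sided_derivative_near_eq (R : realType) (e : R) (f g : R -> R) (t d : R) :
  (\forall h \near (0 : R)^'+, f (t + e * h) = g (t + e * h)) -> f t = g t ->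
  sided_derivative e f t d -> sided_derivative e g t d.
Proof.
move=> fg fgt; apply: cvg_trans; apply: near_eq_cvg; near=> h.
have <- : f (t + e * h) = g (t + e * h) by near: h.
by rewrite -fgt.
Unshelve. all: by end_near. Qed.

Lemma sided_derivative_cst (R : realType) (e c t : R) :
  sided_derivative e (cst c) t 0.
Proof.
rewrite /sided_derivative /cst; under eq_fun do rewrite subrr mulr0.
exact: cvg_cst.
Qed.

Lemma sided_derivativeD (R : realType) (e : R) (f g : R -> R) (t df dg : R) :
  sided_derivative e f t df -> sided_derivative e g t dg ->
  sided_derivative e (fun s => f s + g s) t (df + dg).
Proof.
move=> sf sg; rewrite /sided_derivative.
under eq_fun do rewrite opprD addrACA mulrDr.
exact: cvgD.
Qed.

Lemma sided_derivativeM (R : realType) (e : R) (f g : R -> R) (t df dg : R) :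
  e != 0 -> sided_derivative e f t df -> sided_derivative e g t dg ->
  sided_derivative e (fun s => f s * g s) t (df * g t + f t * dg).
Proof.
move=> e0 sf sg; have gc := sided_derivative_cvg e0 sg.
move: sf => /(sided_derivativeP _ _ _ e0)[kf kfE kfd].
move: sg => /(sided_derivativeP _ _ _ e0)[kg kgE kgd].
apply/sided_derivativeP => //.
exists (fun h => kf h * g (t + e * h) + f t * kg h).
  near=> h.
  have -> : forall a b c d : R, a * b - c * d = (a - c) * b + c * (b - d).
    by move=> *; ring.
  have -> : f (t + e * h) - f t = kf h * (e * h) by near: h.
  have -> : g (t + e * h) - g t = kg h * (e * h) by near: h.
  ring.
apply: cvgD; first exact: cvgM.
by apply: cvgM => //; exact: cvg_cst.
Unshelve. all: by end_near. Qed.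

Lemma sided_derivativeZ (R : realType) (e : R) (c : R) (g : R -> R) (t d : R) :
  sided_derivative e g t d ->
  sided_derivative e (fun s => c * g s) t (c * d).
Proof.
move=> sg; rewrite /sided_derivative.
under eq_fun do rewrite -mulrBr mulrCA.
exact: cvgMr.
Qed.

(** The outer function is differentiated on both sides because [g (t + e * h)] may approach [g t]
    from either one. *)
Lemma sided_derivative_comp (R : realType) (e : R) (f g : R -> R) (t df dg : R) :
  e != 0 -> is_derive (g t) (1 : R) f df -> sided_derivative e g t dg ->
  sided_derivative e (fun s => f (g s)) t (df * dg).
Proof.
move=> e0 /is_derive1_caratheodory[k [kE kc <-]] sg.
have gc := sided_derivative_cvg e0 sg.
move: sg => /(sided_derivativeP _ _ _ e0)[kg kgE kgd].
apply/sided_derivativeP => //.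
exists (fun h => k (g (t + e * h)) * kg h).
  near=> h; rewrite kE -mulrA; congr (_ * _).
  by near: h.
apply: cvgM => //; exact: (cvg_comp _ _ gc kc).
Unshelve. all: by end_near. Qed.

Lemma sided_derivative_sum (R : realType) (I : Type) (r : seq I) (e : R)
    (g : I -> R -> R) (t : R) (d : I -> R) :
  (forall i, sided_derivative e (g i) t (d i)) ->
  sided_derivative e (fun s => \sum_(i <- r) g i s) t (\sum_(i <- r) d i).
Proof.
move=> sg; elim: r => [|i r IHr].
  rewrite /sided_derivative; under eq_fun do rewrite !big_nil subrr mulr0.
  by rewrite big_nil; exact: cvg_cst.
rewrite big_cons.
under eq_fun do rewrite big_cons.
exact: sided_derivativeD (sg i) IHr.
Qed.

Lemma has_right_derivativeE (R : realType) (g : R -> R) (t d : R) :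
  has_right_derivative g t d = sided_derivative 1 g t d.
Proof.
rewrite /has_right_derivative /sided_derivative.
by under [in RHS]eq_fun do rewrite mul1r.
Qed.

Lemma has_left_derivativeE (R : realType) (g : R -> R) (t d : R) :
  has_left_derivative g t d <-> sided_derivative (- 1) g t d.
Proof.
rewrite /has_left_derivative /sided_derivative.
rewrite (cvg_at_leftNP _ (0 : R)) oppr0 /comp.
by under [in X in _ <-> X]eq_fun do rewrite mulN1r.
Qed.

Lemma has_derivative_sided (R : realType) (g : R -> R) (t d : R) :
  sided_derivative 1 g t d -> sided_derivative (- 1) g t d ->
  has_derivative g t d.
Proof.
rewrite -has_right_derivativeE -has_left_derivativeE => gr gl.
have gd : h^-1 *: ((g \o shift t) (h *: (1 : R)) - g t) @[h --> (0 : R)^'] --> d.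
  have := @cvg_at_right_left_dnbhs R R^o
    (fun h => h^-1 * (g (t + h) - g t)) 0 d gr gl.
  apply: cvg_trans; apply: near_eq_cvg; near=> h.
  by rewrite /= [_ *: 1]mulr1 [h + t]addrC.
by split; [apply/cvg_ex; exists d | exact: cvg_lim gd].
Unshelve. all: by end_near. Qed.

(** * From almost everywhere derivatives to one-sided derivatives *)

Lemma lebesgue_ae_imply (R : realType) (P Q : R -> Prop) :
  (forall t, P t -> Q t) ->
  {ae (@lebesgue_measure R), forall t, P t} ->
  {ae (@lebesgue_measure R), forall t, Q t}.
Proof.
move=> PQ [A [mA A0 PA]]; exists A; split => // t nQ.
by apply: PA => /= Pt; apply: nQ; exact: PQ.
Qed.

Lemma near_at_right0P (R : realType) (P : R -> Prop) :
  (\forall h \near (0 : R)^'+, P h) <->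
  exists2 d, 0 < d & forall h, 0 < h -> h < d -> P h.
Proof.
split=> [[d /= d0 dP]|[d d0 dP]].
  exists d => // h h0 hd; apply: dP => //=.
  by rewrite sub0r normrN gtr0_norm.
exists d => // h /=; rewrite sub0r normrN => hd h0; apply: dP => //.
by rewrite (le_lt_trans (ler_norm _)).
Qed.

Lemma absolutely_continuous_sub (R : realType) (a b a' b' : R) (g : R -> R) :
  a <= a' -> b' <= b -> absolutely_continuous a b g ->
  absolutely_continuous a' b' g.
Proof.
move=> aa' b'b acg e e0; have [d d0 dP] := acg e e0; exists d => // n u v uv.
apply: dP => i; have [? ? ?] := uv i; split => //; lra.
Qed.

(** Half of the tolerance goes to each term; the added 1 keeps the divisors positive when [k] or [l]
    vanishes. *)
Lemma absolutely_continuous_affine (R : realType) (a b k l : R) (g : R -> R) :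
  absolutely_continuous a b g ->
  absolutely_continuous a b (fun s => k * g s + l * s).
Proof.
move=> acg e e0.
have k0 : 0 < 2 * (`|k| + 1) by have := normr_ge0 k; lra.
have l0 : 0 < 2 * (`|l| + 1) by have := normr_ge0 l; lra.
have [d d0 dP] := acg (e / (2 * (`|k| + 1))) (divr_gt0 e0 k0).
exists (Num.min d (e / (2 * (`|l| + 1)))); first by rewrite lt_min d0 divr_gt0.
move=> n u v uv uvd; rewrite lt_min => /andP[sd sl].
have := dP n u v uv uvd sd; rewrite ltr_pdivlMr// => sk.
move: sl; rewrite ltr_pdivlMr// => sl.
apply: (@le_lt_trans _ _ (\sum_(i < n) (`|k| * `|g (v i) - g (u i)| +
    `|l| * (v i - u i)))).
  apply: ler_sum => i _.
  have -> : k * g (v i) + l * v i - (k * g (u i) + l * u i) =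
    k * (g (v i) - g (u i)) + l * (v i - u i) by ring.
  rewrite (le_trans (ler_normD _ _))// !normrM lerD2l ler_wpM2l//.
  by rewrite ger0_norm//; have [_ ? _] := uv i; rewrite subr_ge0.
rewrite big_split /= -!mulr_sumr.
set A := \sum_(i < n) _ in sk *; set B := \sum_(i < n) _ in sl *.
have A0 : 0 <= A by apply: sumr_ge0.
have B0 : 0 <= B by apply: sumr_ge0 => i _; have [_ ? _] := uv i; rewrite subr_ge0.
lra.
Qed.

(** The monotonicity criterion applies to [g s + (k - c) * s] and [- g s + (c + k) * s], whose
    derivatives are nonnegative almost everywhere. *)
Lemma ac_ae_slope (R : realType) (a b k c : R) (g : R -> R) :
  a <= b -> absolutely_continuous a b g ->
  {ae (@lebesgue_measure R), forall t : R, a < t < b ->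
     exists2 d, `|d - c| <= k & is_derive t (1 : R) g d} ->
  `|g b - g a - c * (b - a)| <= k * (b - a).
Proof.
move=> ab acg aeg.
have affine m l d t : is_derive t (1 : R) g d ->
    is_derive t (1 : R) (fun s => m * g s + l * s) (m * d + l).
  move=> gd; have -> : (fun s => m * g s + l * s) = m \*: g + l \*: id by [].
  have -> : m * d + l = m *: d + l *: (1 : R) by rewrite [l *: 1]mulr1.
  exact: (is_deriveD (is_deriveZ _ gd) (is_deriveZ _ (is_derive_id t 1))).
have lb : 1 * g a + (k - c) * a <= 1 * g b + (k - c) * b.
  apply: (ac_ae_derive_ge0 ab (absolutely_continuous_affine _ _ acg)).
  apply: lebesgue_ae_imply aeg => t /= gd /gd[d]; rewrite ler_norml => /andP[? ?] gt.
  by exists (1 * d + (k - c)); [lra | exact: affine].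
have ub : - 1 * g a + (c + k) * a <= - 1 * g b + (c + k) * b.
  apply: (ac_ae_derive_ge0 ab (absolutely_continuous_affine _ _ acg)).
  apply: lebesgue_ae_imply aeg => t /= gd /gd[d]; rewrite ler_norml => /andP[? ?] gt.
  by exists (- 1 * d + (c + k)); [lra | exact: affine].
rewrite ler_norml; lra.
Qed.

(** [A] is a relation because a differential inclusion only confines the derivative. Between [t] and
    [t + e * h] its values are within [eps] of [c], and the mean value inequality passes this on to
    the difference quotient. *)
Lemma sided_derivative_ae (R : realType) (a b e t c : R) (g : R -> R)
    (A : R -> R -> Prop) :
  e = 1 \/ e = - 1 -> absolutely_continuous a b g -> a <= t <= b ->
  (\forall h \near (0 : R)^'+, a <= t + e * h <= b) ->
  {ae (@lebesgue_measure R), forall s : R, a < s < b ->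
     exists2 d, A s d & is_derive s (1 : R) g d} ->
  (forall eps, 0 < eps ->
    \forall h \near (0 : R)^'+, forall d, A (t + e * h) d -> `|d - c| <= eps) ->
  sided_derivative e g t c.
Proof.
move=> e1 acg /andP[at_ tb] /near_at_right0P[d1 d10 d1P] aeg lim.
apply/cvgrPdist_le => /= eps eps0.
have /near_at_right0P[d2 d20 d2P] := lim _ eps0.
apply/near_at_right0P; exists (Num.min d1 d2); first by rewrite lt_min d10.
move=> h h0; rewrite lt_min => /andP[hd1 hd2].
have /andP[ah hb] := d1P _ h0 hd1.
rewrite distrC; case: e1 d1P d2P ah hb {lim} => ->.
  rewrite !mul1r => d1P d2P ah hb.
  have : `|g (t + h) - g t - c * (t + h - t)| <= eps * (t + h - t).
    apply: ac_ae_slope; first lra.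
      by apply: absolutely_continuous_sub acg; lra.
    apply: lebesgue_ae_imply aeg => s /= gs /andP[ts sh].
    have [|d Ad gd] := gs; first by apply/andP; split; lra.
    exists d => //; apply: (d2P (s - t)); [lra|lra|].
    by rewrite mul1r addrC subrK.
  rewrite [t + h]addrC addrK => H.
  have -> : h^-1 * (g (h + t) - g t) - c = (g (h + t) - g t - c * h) / h.
    by field; rewrite gt_eqF.
  by rewrite normrM normfV (gtr0_norm h0) ler_pdivrMr.
rewrite !mulN1r => d1P d2P ah hb.
have : `|g t - g (t - h) - c * (t - (t - h))| <= eps * (t - (t - h)).
  apply: ac_ae_slope; first lra.
    by apply: absolutely_continuous_sub acg; lra.
  apply: lebesgue_ae_imply aeg => s /= gs /andP[ts sh].
  have [|d Ad gd] := gs; first by apply/andP; split; lra.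
  exists d => //; apply: (d2P (t - s)); [lra|lra|].
  by rewrite mulN1r opprB addrC subrK.
rewrite subKr => H.
have -> : (- h)^-1 * (g (t - h) - g t) - c = (g t - g (t - h) - c * h) / h.
  by field; rewrite gt_eqF.
by rewrite normrM normfV (gtr0_norm h0) ler_pdivrMr.
Qed.

Lemma absolutely_continuous_uniform (R : realType) (a b : R) (g : R -> R) :
  absolutely_continuous a b g -> forall eps, 0 < eps -> exists2 d, 0 < d &
    forall s t, a <= s <= b -> a <= t <= b -> `|s - t| < d -> `|g s - g t| < eps.
Proof.
move=> acg eps eps0; have [d d0 dP] := acg eps eps0; exists d => // s t.
wlog ts : s t / t <= s => [wl|/andP[as_ sb] /andP[at_ tb] std].
  have [ts|/ltW st] := leP t s; first exact: wl.
  by move=> sab tab; rewrite distrC [`|g s - _|]distrC; exact: wl.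
(* A single interval in the definition of absolute continuity. *)
have := dP 1%N (fun=> t) (fun=> s); rewrite !big_ord_recl !big_ord0 !addr0.
apply => //; first by move=> i j; rewrite !ord1 eqxx.
by rewrite -(@ger0_norm _ (s - t))// subr_ge0.
Qed.

Lemma absolutely_continuous_cvg (R : realType) (a b e t : R) (g : R -> R) :
  absolutely_continuous a b g -> a <= t <= b -> e = 1 \/ e = - 1 ->
  (\forall h \near (0 : R)^'+, a <= t + e * h <= b) ->
  g (t + e * h) @[h --> (0 : R)^'+] --> g t.
Proof.
move=> acg tab e1 hab; apply/cvgrPdist_lt => eps eps0.
have [d d0 dP] := absolutely_continuous_uniform acg eps0.
near=> h; apply: dP => //; first by near: h.
have h0 : 0 < h by near: h; exact: nbhs_right_gt.
have hd : h < d by near: h; exact: nbhs_right_lt.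
rewrite opprD addNKr normrN normrM (gtr0_norm h0).
by case: e1 => ->; rewrite ?normrN normr1 mul1r.
Unshelve. all: by end_near. Qed.

(** Clamping the time is 1-Lipschitz and freezes [g] outside [[a, b]], so uniform continuity on
    [[a, b]] extends to the whole line. *)
Lemma absolutely_continuous_clamp (R : realType) (a b : R) (g : R -> R) :
  a <= b -> absolutely_continuous a b g ->
  continuous (fun s => g (Num.max a (Num.min b s))).
Proof.
move=> ab acg t; apply/cvgrPdist_lt => eps eps0.
have [d d0 dP] := absolutely_continuous_uniform acg eps0.
have clampP s : a <= Num.max a (Num.min b s) <= b.
  by rewrite le_max lexx ge_max ab ge_min lexx.
exists d => // s /= td; apply: dP => //; apply: le_lt_trans td.
case: (leP b t) => ?; case: (leP b s) => ?; 
  case: (leP a b) => ?; case: (leP a t) => ?; case: (leP a s) => ?;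
  rewrite ?subrr ?normr0 ?normr_ge0//;
  have := ler_norm (t - s); have := ler_norm (s - t); rewrite [`|s - t|]distrC => ? ?;
  rewrite ler_norml; lra.
Qed.

(** * One-sided derivatives of Filippov solutions *)

Section ColumnConvergence.
Variables (R : realType) (F : set_system R).
Context {FF : Filter F}.

(** Entrywise, since solutions are described entry by entry. *)
Definition col_cvg (N : nat) (x : R -> 'cV[R]_N) (y : 'cV[R]_N) : Prop :=
  forall i, x h i 0 @[h --> F] --> y i 0.

Lemma col_cvgM (k N : nat) (A : 'M[R]_(k, N)) (x : R -> 'cV[R]_N) y :
  col_cvg x y -> col_cvg (fun h => A *m x h) (A *m y).
Proof.
move=> xy i; rewrite mxE; under eq_fun do rewrite mxE.
by apply: cvg_big => [|j _]; [exact: add_continuous | apply: cvgMr; exact: xy].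
Qed.

Lemma col_cvgD (N : nat) (x x' : R -> 'cV[R]_N) y y' :
  col_cvg x y -> col_cvg x' y' -> col_cvg (fun h => x h + x' h) (y + y').
Proof.
move=> xy xy' i; rewrite mxE; under eq_fun do rewrite mxE.
exact: cvgD (xy i) (xy' i).
Qed.

Lemma col_cvgN (N : nat) (x : R -> 'cV[R]_N) y :
  col_cvg x y -> col_cvg (fun h => - x h) (- y).
Proof.
move=> xy i; rewrite mxE; under eq_fun do rewrite mxE.
exact: cvgN (xy i).
Qed.

Variables (N : nat) (S : mech R N) (p : R -> state R N) (q : state R N).
Hypotheses (pq1 : col_cvg (fun h => (p h).1) q.1)
  (pq2 : col_cvg (fun h => (p h).2) q.2).

Lemma acc_free_cvg : col_cvg (fun h => acc_free S (p h)) (acc_free S q).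
Proof. by apply: col_cvgN; apply: col_cvgM; apply: col_cvgD; exact: col_cvgM. Qed.

Lemma acc_contact_cvg : col_cvg (fun h => acc_contact S (p h)) (acc_contact S q).
Proof. by apply: col_cvgN; apply: col_cvgM; apply: col_cvgD; exact: col_cvgM. Qed.

Lemma h_alpha_cvg : h_alpha S (p h) @[h --> F] --> h_alpha S q.
Proof. exact: col_cvgM. Qed.

Lemma h_beta_cvg : h_beta S (p h) @[h --> F] --> h_beta S q.
Proof. by apply: cvgD; apply: cvgMr; exact: col_cvgM. Qed.

End ColumnConvergence.

(* The limit of the Filippov accelerations along a solution through p, taken
   after p for e = 1 and before p for e = -1. *)
Definition side_acc (R : realType) (N : nat) (S : mech R N) (e : R)
    (p : state R N) : 'cV[R]_N :=
  if `[< crossing_set S p >] then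
    if 0 < e then acc_contact S p else acc_free S p
  else accel S p.

(** * Positive homogeneity and the Filippov segment *)

Section Homogeneity.
Variables (R : realType) (N : nat) (S : mech R N).
Implicit Types (p : state R N) (l : R).

Lemma acc_freeZ l p : acc_free S (l *: p) = l *: acc_free S p.
Proof. by rewrite /acc_free /= -!scalemxAr -scalerDr -scalemxAr scalerN. Qed.

Lemma acc_contactZ l p : acc_contact S (l *: p) = l *: acc_contact S p.
Proof. by rewrite /acc_contact /= -!scalemxAr -scalerDr -scalemxAr scalerN. Qed.

Lemma h_alphaZ l p : h_alpha S (l *: p) = l * h_alpha S p.
Proof. by rewrite /h_alpha /= -!scalemxAr mxE. Qed.

Lemma h_betaZ l p : h_beta S (l *: p) = l * h_beta S p.
Proof.
have E (z : 'cV[R]_N) :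
    ((wvec S)^T *m (l *: z)) 0 0 = l * ((wvec S)^T *m z) 0 0.
  by rewrite -scalemxAr mxE.
by rewrite /h_beta /= !E; ring.
Qed.

Lemma accelZ l p : 0 < l -> accel S (l *: p) = l *: accel S p.
Proof.
move=> l0; rewrite /accel /in_contact h_alphaZ h_betaZ !pmulr_rgt0//.
by case: ifP => _; rewrite (acc_contactZ, acc_freeZ).
Qed.

Lemma crossing_setZ l p : 0 < l -> crossing_set S (l *: p) <-> crossing_set S p.
Proof.
move=> l0; rewrite /crossing_set /= h_alphaZ h_betaZ pmulr_rgt0//.
split=> -[pa pb]; split => //; last by rewrite pa mulr0.
by move/eqP: pa; rewrite mulf_eq0 gt_eqF//= => /eqP.
Qed.

(** Positive scaling preserves the crossing set, so the branch chosen is constant on rays. This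
    relates accelerations along a solution to those at [G theta]. *)
Lemma side_accZ e l p : 0 < l -> side_acc S e (l *: p) = l *: side_acc S e p.
Proof.
move=> l0; rewrite /side_acc.
have -> : `[< crossing_set S (l *: p) >] = `[< crossing_set S p >].
  by apply/asbool_equiv_eq; exact: crossing_setZ.
by case: ifP => _; [case: ifP => _; rewrite (acc_contactZ, acc_freeZ) | rewrite accelZ].
Qed.

(** The zones give the end points of the segment, with weight 1 in contact and 0 without, so the
    three cases of the inclusion are treated alike. *)
Lemma filippov_segment p a : filippov S p a -> exists2 l, 0 <= l <= 1 &
  a = (1 - l) *: acc_free S p + l *: acc_contact S p.
Proof.
move=> [pc pn ps]; have [ic|nic] := boolP (in_contact S p).
  by exists 1; rewrite ?ler01 ?lexx// subrr scale0r add0r scale1r pc.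
have [inc|ninc] := boolP (no_contact S p).
  by exists 0; rewrite ?ler01 ?lexx// subr0 scale0r addr0 scale1r pn.
by have [//|l [l0 l1 ->]] := ps; exists l; rewrite ?l0.
Qed.

(** The contact terms add up to [h_beta S p *: wvec S] inside the bracket multiplied by the inverse
    mass matrix. *)
Lemma acc_contact_free p :
  h_beta S p = 0 -> acc_contact S p = acc_free S p.
Proof.
move=> hb; rewrite /acc_contact /acc_free; congr (- (_ *m _)).
rewrite !mulmxDl addrACA -[RHS]addr0; congr (_ + _).
rewrite -!scalemxAl -!mulmxA.
have wE (z : 'cV[R]_N) : wvec S *m ((wvec S)^T *m z) =
    (((wvec S)^T *m z) 0 0) *: wvec S.
  by rewrite {1}[_^T *m z]mx11_scalar mul_mx_scalar.
rewrite !wE !scalerA -scalerDl addrC.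
by move: hb; rewrite /h_beta => ->; rewrite scale0r.
Qed.

End Homogeneity.

Section OneSidedSolution.
Variables (R : realType) (N : nat) (S : mech R N) (a b e t : R).
Variable phi : R -> state R N.
Hypotheses (admS : admissible S) (sol : is_solution S a b phi).
Hypotheses (e1 : e = 1 \/ e = - 1) (tab : a <= t <= b)
  (hab : \forall h \near (0 : R)^'+, a <= t + e * h <= b).

Lemma sol_cvg1 : col_cvg (0 : R)^'+ (fun h => (phi (t + e * h)).1) (phi t).1.
Proof. by move=> i; apply: absolutely_continuous_cvg (sol.1 i).1 tab e1 hab. Qed.

Lemma sol_cvg2 : col_cvg (0 : R)^'+ (fun h => (phi (t + e * h)).2) (phi t).2.
Proof. by move=> i; apply: absolutely_continuous_cvg (sol.1 i).2 tab e1 hab. Qed.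

Lemma sol_sided_derivative1 i :
  sided_derivative e (fun s => (phi s).1 i 0) t ((phi t).2 i 0).
Proof.
apply: (sided_derivative_ae (A := fun s d => d = (phi s).2 i 0)
  e1 (sol.1 i).1 tab hab).
  apply: lebesgue_ae_imply sol.2 => s /= ds /ds[acc _ /(_ i)[d1 _]].
  by exists ((phi s).2 i 0).
move=> eps eps0; near=> h => _ ->; near: h.
by apply: cvgr_distC_le eps0; exact: sol_cvg2.
Unshelve. all: by end_near. Qed.

(* On the crossing set the switching function h_alpha has derivative
   h_beta / c_n > 0, which decides the zone on either side. *)
Lemma crossing_zone : crossing_set S (phi t) ->
  \forall h \near (0 : R)^'+,
    if 0 < e then in_contact S (phi (t + e * h))
    else no_contact S (phi (t + e * h)).
Proof.
move=> [ha hb].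
(* With [h_alpha] zero, [h_beta] reduces to its [cn S] term, whose positivity excludes
   [cn S = 0]. *)
have wy : 0 < ((wvec S)^T *m (phi t).2) 0 0.
  move: hb; rewrite /h_beta -/(h_alpha S (phi t)) ha mulr0 add0r.
  have [_ [_ _ _ cn0]] := admS.
  by move: cn0; rewrite le_eqVlt => /orP[/eqP<-|cn0];
    rewrite ?mul0r ?ltxx ?pmulr_rgt0.
have da : sided_derivative e (fun s => h_alpha S (phi s)) t
    (((wvec S)^T *m (phi t).2) 0 0).
  rewrite /h_alpha mxE; under eq_fun do rewrite mxE.
  apply: (sided_derivative_sum (g := fun j s => (wvec S)^T 0 j * (phi s).1 j 0)
    (d := fun j => (wvec S)^T 0 j * (phi t).2 j 0)) => j.
  apply: sided_derivativeZ; exact: sol_sided_derivative1.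
have hb' := h_beta_cvg (@sol_cvg1) (@sol_cvg2).
rewrite /sided_derivative ha in da.
near=> h.
have h0 : 0 < h by near: h; exact: nbhs_right_gt.
have : 0 < (e * h)^-1 * (h_alpha S (phi (t + e * h)) - 0).
  by near: h; apply: cvgr_gt; first exact: da.
have : 0 < h_beta S (phi (t + e * h)) by near: h; apply: cvgr_gt; first exact: hb'.
rewrite subr0 /in_contact /no_contact.
case: e1 => ->.
  by rewrite ltr01 mul1r pmulr_rgt0 ?invr_gt0// => -> ->.
by rewrite ltr0N1 mulN1r invrN mulNr oppr_gt0 pmulr_rlt0 ?invr_gt0// => _ ->.
Unshelve. all: by end_near. Qed.

(** On the crossing set the zone on each side is known, and inside either zone it persists by
    continuity. At the remaining points [h_beta] vanishes, both expressions share one limit, and so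
    do their convex combinations. *)
Lemma filippov_side_cvg i eps : 0 < eps ->
  \forall h \near (0 : R)^'+, forall acc, filippov S (phi (t + e * h)) acc ->
    `|acc i 0 - side_acc S e (phi t) i 0| <= eps.
Proof.
move=> eps0.
have cf : \forall h \near (0 : R)^'+,
    `|acc_free S (phi (t + e * h)) i 0 - acc_free S (phi t) i 0| <= eps.
  apply: cvgr_distC_le eps0; exact: (@acc_free_cvg _ _ _ _ S _ _ (@sol_cvg1) (@sol_cvg2) i).
have cc : \forall h \near (0 : R)^'+,
    `|acc_contact S (phi (t + e * h)) i 0 - acc_contact S (phi t) i 0| <= eps.
  apply: cvgr_distC_le eps0; exact: (@acc_contact_cvg _ _ _ _ S _ _ (@sol_cvg1) (@sol_cvg2) i).
have ha := h_alpha_cvg (@sol_cvg1).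
have hb := h_beta_cvg (@sol_cvg1) (@sol_cvg2).
have in_free : (\forall h \near (0 : R)^'+, no_contact S (phi (t + e * h))) ->
    side_acc S e (phi t) = acc_free S (phi t) ->
    \forall h \near (0 : R)^'+, forall acc, filippov S (phi (t + e * h)) acc ->
    `|acc i 0 - side_acc S e (phi t) i 0| <= eps.
  move=> nc ->; near=> h => acc [_ fh _].
  have -> : acc = acc_free S (phi (t + e * h)) by apply: fh; near: h.
  by near: h.
have in_cont : (\forall h \near (0 : R)^'+, in_contact S (phi (t + e * h))) ->
    side_acc S e (phi t) = acc_contact S (phi t) ->
    \forall h \near (0 : R)^'+, forall acc, filippov S (phi (t + e * h)) acc ->
    `|acc i 0 - side_acc S e (phi t) i 0| <= eps.
  move=> ic ->; near=> h => acc [fh _ _].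
  have -> : acc = acc_contact S (phi (t + e * h)) by apply: fh; near: h.
  by near: h.
have [cr|ncr] := pselect (crossing_set S (phi t)).
  have := crossing_zone cr.
  have sE : side_acc S e (phi t) =
      if 0 < e then acc_contact S (phi t) else acc_free S (phi t).
    by rewrite /side_acc asboolT.
  by case: ifP sE => _ sE Hz; [exact: in_cont | exact: in_free].
have sE : side_acc S e (phi t) = accel S (phi t) by rewrite /side_acc asboolF.
have [ic|nic] := boolP (in_contact S (phi t)).
  apply: in_cont; last by rewrite sE /accel ic.
  case/andP: ic => ? ?; near=> h; rewrite /in_contact; apply/andP; split.
    by near: h; apply: cvgr_gt; first exact: ha.
  by near: h; apply: cvgr_gt; first exact: hb.
have aE : accel S (phi t) = acc_free S (phi t) by rewrite /accel (negbTE nic).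
have [inc|ninc] := boolP (no_contact S (phi t)).
  apply: in_free; last by rewrite sE aE.
  case/orP: inc => hlt.
    near=> h; apply/orP; left.
    by near: h; apply: cvgr_lt; first exact: ha.
  near=> h; apply/orP; right.
  by near: h; apply: cvgr_lt; first exact: hb.
(* Outside both zones [h_alpha] and [h_beta] are nonnegative; a positive [h_beta] would then mean
   contact or crossing. *)
have hb0 : h_beta S (phi t) = 0.
  apply/eqP; rewrite eq_le; move: ninc; rewrite negb_or -!leNgt => /andP[ga gb].
  rewrite gb andbT leNgt; apply/negP => bgt; apply: ncr; split => //.
  apply/eqP; rewrite eq_le ga andbT leNgt; apply/negP => agt.
  by move: nic; rewrite /in_contact agt bgt.
rewrite sE aE; rewrite (acc_contact_free hb0) in cc.
near=> h => acc /filippov_segment[l /andP[l0 l1] ->].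
have cfh : `|acc_free S (phi (t + e * h)) i 0 - acc_free S (phi t) i 0| <= eps.
  by near: h.
have cch : `|acc_contact S (phi (t + e * h)) i 0 - acc_free S (phi t) i 0| <= eps.
  by near: h.
rewrite [X in `|X - _|]mxE [X in `|X + _ - _|]mxE [X in `|_ + X - _|]mxE.
 set A := acc_free _ (phi (t + _)) _ _ in cfh *; set B := acc_contact _ _ _ _ in cch *.
set c := acc_free _ _ _ _ in cfh cch *.
have -> : (1 - l) * A + l * B - c = (1 - l) * (A - c) + l * (B - c) by ring.
apply: le_trans (ler_normD _ _) _; rewrite !normrM (ger0_norm l0) ger0_norm; last lra.
have -> : eps = (1 - l) * eps + l * eps by ring.
by apply: lerD; apply: ler_wpM2l => //; lra.
Unshelve. all: by end_near. Qed.

Lemma sol_sided_derivative2 i :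
  sided_derivative e (fun s => (phi s).2 i 0) t (side_acc S e (phi t) i 0).
Proof.
apply: (sided_derivative_ae
  (A := fun s d => exists2 acc, filippov S (phi s) acc & d = acc i 0)
  e1 (sol.1 i).2 tab hab).
  apply: lebesgue_ae_imply sol.2 => s /= ds /ds[acc fa /(_ i)[_ d2]].
  by exists (acc i 0); first exists acc.
move=> eps eps0; have H := filippov_side_cvg i eps0; near=> h => d [acc fa ->].
have H1 : forall acc, filippov S (phi (t + e * h)) acc ->
  `|acc i 0 - side_acc S e (phi t) i 0| <= eps by near: h.
exact: H1.
Unshelve. all: by end_near. Qed.

End OneSidedSolution.

(** * Polar coordinates and inversion of the angle *)

Lemma sided_derivativeV (R : realType) (e : R) (g : R -> R) (t d : R) :
  e != 0 -> g t != 0 -> sided_derivative e g t d ->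
  sided_derivative e (fun s => (g s)^-1) t (- d / g t ^+ 2).
Proof.
move=> e0 gt0 sg; have -> : - d / g t ^+ 2 = - (g t) ^- 2 *: 1 * d.
  by rewrite [_ *: 1]mulr1; field.
apply: (sided_derivative_comp (f := fun x => x^-1)) => //.
exact: (is_deriveV (f := id)).
Qed.

(** At a zero of [V] the quotient rule keeps only [dV / U t], and the arctangent has derivative 1 at
    0. *)
Lemma sided_derivative_atan_ratio (R : realType) (e : R) (U V : R -> R)
    (t dU dV : R) :
  e != 0 -> U t != 0 -> V t = 0 ->
  sided_derivative e U t dU -> sided_derivative e V t dV ->
  sided_derivative e (fun s => atan (V s / U s)) t (dV / U t).
Proof.
move=> e0 Ut Vt sU sV.
have sq := sided_derivativeM e0 sV (sided_derivativeV e0 Ut sU).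
have := sided_derivative_comp (g := fun s => V s / U s) e0
  (is_derive1_atan (V t / U t)) sq.
by rewrite Vt !mul0r addr0 expr0n addr0 invr1 mul1r.
Qed.

(** The radius is the square root of [u * u + v * v]. For the angle, rotating by [th t] makes the
    second coordinate vanish at [t], and near [t] the angle is [th t] plus an arctangent. *)
Lemma polar_sided_derivative (R : realType) (e : R) (u v r th : R -> R)
    (t du dv : R) :
  e != 0 ->
  (\forall h \near (0 : R)^'+, [/\ 0 < r (t + e * h),
     u (t + e * h) = r (t + e * h) * cos (th (t + e * h)) &
     v (t + e * h) = r (t + e * h) * sin (th (t + e * h))]) ->
  [/\ 0 < r t, u t = r t * cos (th t) & v t = r t * sin (th t)] ->
  th (t + e * h) @[h --> (0 : R)^'+] --> th t ->
  sided_derivative e u t du -> sided_derivative e v t dv ->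
  sided_derivative e r t (cos (th t) * du + sin (th t) * dv) /\
  sided_derivative e th t ((cos (th t) * dv - sin (th t) * du) / r t).
Proof.
move=> e0 pol [rt ut vt] thc su sv.
have rE s : 0 < r s -> u s = r s * cos (th s) -> v s = r s * sin (th s) ->
    Num.sqrt (u s * u s + v s * v s) = r s.
  move=> rs -> ->; rewrite -[RHS]ger0_norm ?ltW// -sqrtr_sqr; congr Num.sqrt.
  rewrite -[RHS]mulr1 -(cos2Dsin2 (th s)); ring.
have wt : u t * u t + v t * v t = r t ^+ 2.
  by rewrite ut vt -[RHS]mulr1 -(cos2Dsin2 (th t)); ring.
split.
  have sw := sided_derivativeD (sided_derivativeM e0 su su) (sided_derivativeM e0 sv sv).
  have w0 : 0 < u t * u t + v t * v t by rewrite wt exprn_gt0.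
  have := sided_derivative_comp (g := fun s => u s * u s + v s * v s) e0
    (is_derive1_sqrt w0) sw.
  rewrite (rE t)// ut vt.
  have -> : (2 * r t)^-1 * (du * (r t * cos (th t)) + r t * cos (th t) * du +
      (dv * (r t * sin (th t)) + r t * sin (th t) * dv)) =
      cos (th t) * du + sin (th t) * dv by field; rewrite gt_eqF.
  apply: sided_derivative_near_eq; last by rewrite rE.
  near=> h; have [? ? ?] : [/\ 0 < r (t + e * h),
     u (t + e * h) = r (t + e * h) * cos (th (t + e * h)) &
     v (t + e * h) = r (t + e * h) * sin (th (t + e * h))] by near: h.
  exact: rE.
pose c := cos (th t); pose s := sin (th t).
pose U x := c * u x + s * v x; pose V x := c * v x + - s * u x.
have sU := sided_derivativeD (sided_derivativeZ (c := c) su) (sided_derivativeZ (c := s) sv).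
have sV := sided_derivativeD (sided_derivativeZ (c := c) sv) (sided_derivativeZ (c := - s) su).
have Ut : U t = r t.
  by rewrite /U ut vt -[RHS]mulr1 -(cos2Dsin2 (th t)) /c /s; ring.
have Vt : V t = 0 by rewrite /V ut vt /c /s; ring.
have Ut0 : U t != 0 by rewrite Ut gt_eqF.
have := sided_derivative_atan_ratio e0 Ut0 Vt sU sV.
rewrite Ut mulNr => sA.
have := sided_derivativeD (sided_derivative_cst e (th t) t) sA.
rewrite add0r; apply: sided_derivative_near_eq; last first.
  by rewrite /cst Vt mul0r atan0 addr0.
have pi0 : 0 < pi / 2 :> R by rewrite divr_gt0// pi_gt0.
near=> h; have [r0 uE vE] : [/\ 0 < r (t + e * h),
     u (t + e * h) = r (t + e * h) * cos (th (t + e * h)) &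
     v (t + e * h) = r (t + e * h) * sin (th (t + e * h))] by near: h.
(* Continuity of [th] keeps the rotated angle in the principal range of the arctangent. *)
have : `|th (t + e * h) - th t| < pi / 2.
  by near: h; apply: cvgr_distC_lt pi0; exact: thc.
set x := t + e * h in r0 uE vE *; rewrite ltr_norml => /andP[dl dr].
have -> : U x = r x * cos (th x - th t) by rewrite /U uE vE cosB /c /s; ring.
have -> : V x = r x * sin (th x - th t) by rewrite /V uE vE sinB /c /s; ring.
rewrite -mulf_div divff ?gt_eqF// mul1r tanK; first by rewrite /cst; ring.
by rewrite in_itv/= dl.
Unshelve. all: by end_near. Qed.

(** In the frame rotated by [th] the point lies in the right half-plane, where the arctangent
    measures its angle. *)
Lemma polar_atan (R : realType) (u v th : R) :
  let U := cos th * u + sin th * v in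
  let V := cos th * v - sin th * u in
  let rho := Num.sqrt (u ^+ 2 + v ^+ 2) in
  0 < U ->
  [/\ 0 < rho, u = rho * cos (th + atan (V / U)) &
      v = rho * sin (th + atan (V / U))].
Proof.
move=> U V rho U0.
have uE : u = cos th * U - sin th * V.
  by rewrite -[LHS]mul1r -(cos2Dsin2 th) /U /V; ring.
have vE : v = sin th * U + cos th * V.
  by rewrite -[LHS]mul1r -(cos2Dsin2 th) /U /V; ring.
have wE : u ^+ 2 + v ^+ 2 = U ^+ 2 + V ^+ 2.
  by rewrite uE vE -[RHS]mul1r -(cos2Dsin2 th); ring.
have w0 : 0 < u ^+ 2 + v ^+ 2.
  by rewrite wE ltr_pwDl ?exprn_gt0// sqr_ge0.
have rho0 : 0 < rho by rewrite sqrtr_gt0.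
set d := atan (V / U).
have c0 : 0 < cos d by apply: cos_gt0_pihalf; rewrite atan_gtNpi2 atan_ltpi2.
have tE : V * cos d = U * sin d.
  have dE : sin d / cos d = V / U := atanK (V / U).
  have -> : V * cos d = V / U * (U * cos d) by field; rewrite gt_eqF.
  by rewrite -dE; field; rewrite gt_eqF.
(* Both sides are positive, so it suffices to compare squares. *)
have UE : rho * cos d = U.
  apply/eqP; rewrite -(@eqrXn2 _ 2)//; [|exact/ltW/mulr_gt0|exact/ltW].
  rewrite exprMn sqr_sqrtr ?ltW// wE mulrDl -[V ^+ 2 * _]exprMn tE exprMn -mulrDr.
  by rewrite cos2Dsin2 mulr1.
have VE : rho * sin d = V.
  have c0' : cos d != 0 by rewrite gt_eqF.
  by apply: (mulIf c0'); rewrite tE -UE; ring.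
by split; rewrite // (cosD, sinD) {1}(uE, vE) -UE -VE; ring.
Qed.

(** Time side [e] corresponds to angle side [e * Num.sg dth]. By the intermediate value theorem each
    nearby angle on that side is attained at a small time, where the quotient of [p] is the
    increment of [z] over that of [th]. *)
Lemma sided_derivative_inverse (R : realType) (e eta t dth dz : R)
    (th z p : R -> R) :
  e = 1 \/ e = - 1 -> 0 < eta -> dth != 0 ->
  {in `[0, eta], continuous (fun s => th (t + e * s))} ->
  (forall s, 0 <= s <= eta -> p (th (t + e * s)) = z (t + e * s)) ->
  sided_derivative e th t dth -> sided_derivative e z t dz ->
  sided_derivative (e * Num.sg dth) p (th t) (dz / dth).
Proof.
move=> e1 eta0 dth0 thc pz sth sz; set sig := e * Num.sg dth.
have e0 : e != 0 by case: e1 => ->; rewrite ?oppr_eq0 oner_eq0.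
have ee : e * e = 1 by case: e1 => ->; ring.
have sig2 : sig * sig = 1.
  rewrite /sig mulrACA ee mul1r -expr2 sqr_sg dth0//.
have sig0 : sig != 0 by apply/eqP => s0; move: sig2; rewrite s0 mul0r => /esym/eqP; rewrite oner_eq0.
(* The angular displacement, signed so as to be positive for small positive [s]. *)
pose al s := sig * (th (t + e * s) - th t).
have al0 : al 0 = 0 by rewrite /al mulr0 addr0 subrr mulr0.
have alc : {in `[0, eta], continuous al}.
  move=> s sE; apply: cvgMr; apply: cvgB; [exact: thc | exact: cvg_cst].
pose k s := (z (t + e * s) - z t) / (th (t + e * s) - th t).
have kc : k h @[h --> (0 : R)^'+] --> dz / dth.
  have : ((e * h)^-1 * (z (t + e * h) - z t)) /
         ((e * h)^-1 * (th (t + e * h) - th t)) @[h --> (0 : R)^'+] --> dz / dth.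
    by apply: cvgM => //; exact: cvgV.
  apply: cvg_trans; apply: near_eq_cvg; near=> h.
  have h0 : h != 0 by rewrite gt_eqF//; near: h; exact: nbhs_right_gt.
  by rewrite -mulf_div divff ?mul1r// invr_eq0 mulf_neq0.
have alp : \forall h \near (0 : R)^'+, 0 < al h.
  have dth1 : 0 < `|dth| by rewrite normr_gt0.
  have c : sig * e * ((e * h)^-1 * (th (t + e * h) - th t)) @[h --> (0 : R)^'+]
      --> `|dth|.
    have -> : `|dth| = sig * e * dth.
      have -> : sig * e = Num.sg dth by rewrite /sig -[RHS]mul1r -ee; ring.
      exact: normrEsg.
    exact: cvgMr.
  near=> h.
  have h0 : 0 < h by near: h; exact: nbhs_right_gt.
  have : 0 < sig * e * ((e * h)^-1 * (th (t + e * h) - th t)).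
    by near: h; apply: cvgr_gt dth1; exact: c.
  have -> : sig * e * ((e * h)^-1 * (th (t + e * h) - th t)) = h^-1 * al h.
    by rewrite /al; field; rewrite e0 gt_eqF.
  by rewrite pmulr_rgt0 ?invr_gt0.
apply/cvgrPdist_le => /= eps eps0.
have kd : \forall h \near (0 : R)^'+, `|dz / dth - k h| <= eps.
  by apply: cvgr_dist_le eps0; exact: kc.
have /near_at_right0P[d1 d10 d1P] := kd.
have /near_at_right0P[d2 d20 d2P] := alp.
(* Up to [s1] the quotient [k] stays within [eps] of its limit, and [al s1] is positive: it is the
   radius of the neighbourhood sought. *)
pose s1 := Num.min eta (Num.min d1 d2) / 2.
have m0 : 0 < Num.min eta (Num.min d1 d2) by rewrite !lt_min eta0 d10.
have [s10 s1e s1d1 s1d2] : [/\ 0 < s1, s1 <= eta, s1 < d1 & s1 < d2].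
  have : s1 < Num.min eta (Num.min d1 d2) by rewrite /s1; lra.
  by rewrite !lt_min => /and3P[? ? ?]; split; rewrite // ?ltW// /s1; lra.
apply/near_at_right0P; exists (al s1); first exact: d2P.
move=> y y0 ys.
have als1 : {within `[0, s1], continuous al}.
  apply: continuous_in_subspaceT => s; rewrite inE /= in_itv /= => /andP[? ?].
  by apply: alc; rewrite in_itv /=; lra.
have yal : Num.min (al 0) (al s1) <= y <= Num.max (al 0) (al s1).
  by rewrite al0 ge_min le_max (ltW y0) (ltW ys) orbT.
have [s] := IVT (ltW s10) als1 yal.
rewrite in_itv /= => /andP[s0 ss1] sy.
have {}s0 : 0 < s.
  rewrite lt_neqAle s0 andbT; apply/eqP => s00.
  by move: sy y0; rewrite -s00 al0 => <-; rewrite ltxx.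
have sE : th t + sig * y = th (t + e * s).
  by rewrite -sy /al mulrA sig2 mul1r addrC subrK.
have yE : sig * y = th (t + e * s) - th t by rewrite -sE; ring.
rewrite sE pz; last by rewrite (ltW s0)/=; lra.
have -> : p (th t) = z t.
  by have := pz 0; rewrite mulr0 addr0; apply; rewrite lexx ltW.
rewrite yE [X in _ - X]mulrC; apply: d1P => //; lra.
Unshelve. all: by end_near. Qed.

(** * The invariant cone as a graph *)

Lemma side_acc_crossing (R : realType) (N : nat) (S : mech R N) e p :
  crossing_set S p ->
  side_acc S e p = if 0 < e then acc_contact S p else acc_free S p.
Proof. by move=> cp; rewrite /side_acc asboolT. Qed.

Lemma side_acc_noncrossing (R : realType) (N : nat) (S : mech R N) e p :
  ~ crossing_set S p -> side_acc S e p = accel S p.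
Proof. by move=> ncp; rewrite /side_acc asboolF. Qed.

(** The arccosine gives the angle on the upper half circle, its opposite on the lower one. *)
Lemma angle_exists (R : realType) (x y : R) :
  x ^+ 2 + y ^+ 2 = 1 -> exists th, x = cos th /\ y = sin th.
Proof.
move=> xy1; have x1 : -1 <= x <= 1.
  rewrite -ler_norml -(@ler_sqr _ _ 1) ?nnegrE// expr1n -[`|x| ^+ 2]real_normK.
    by have := sqr_ge0 y; rewrite normr_id real_normK ?num_real//; lra.
  exact: num_real.
have yE : y ^+ 2 = 1 - x ^+ 2 by rewrite -xy1; ring.
have [y0|y0] := leP 0 y.
  exists (acos x); split; first by rewrite acosK// in_itv.
  by rewrite sin_acos// -yE sqrtr_sqr ger0_norm.
exists (- acos x); split; first by rewrite cosN acosK// in_itv.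
by rewrite sinN sin_acos// -yE sqrtr_sqr ltr0_norm// opprK.
Qed.

Section ConeGraph.
Variables (R : realType) (N : nat) (S : mech R N).
Variables (C : set (state R N)) (m : 'I_N).
Hypotheses (coneC : invariant_cone S C) (bijC : rays_biject_generating_set m C).
Hypothesis svC : single_valued_in_angle m C.

Lemma cone0 : C 0.
Proof. by have [-> _ _] := coneC; left. Qed.

Lemma coneZ p l : C p -> 0 < l -> C (l *: p).
Proof.
move=> Cp l0; have [->|p0] := pselect (p = 0).
  by rewrite scaler0; exact: cone0.
have [-> _ _] := coneC; right; exists (ray p); first by exists p.
by exists l.
Qed.

(** The ray of [p] meets the cylinder in the point assigned to it by the bijection; so no nonzero
    state of [C] has a vanishing master pair. *)
Lemma cone_meets_cyl p : C p -> p <> 0 -> exists2 l, 0 < l & H_cyl m (l *: p).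
Proof.
move=> Cp p0; have [g [gE _]] := bijC.
have : (ray p `&` H_cyl m) (g (ray p)) by rewrite gE//; exists p.
by move=> [[l l0 <-] Hl]; exists l.
Qed.

(** [P] and [Q] are read off a choice of states by angle. Uniqueness at each angle identifies
    [r^-1 *: p] with [G th], and it gives periodicity since cosine and sine agree at 0 and
    [2 * pi]. *)
Lemma cone_graph : exists P Q : 'I_N -> R -> R,
  let G := graph_state m P Q in
  [/\ forall th, generating_set m C (G th),
      forall p r th, C p -> 0 <= r ->
        p.1 m 0 = r * cos th -> p.2 m 0 = r * sin th -> p = r *: G th &
      forall j, P j 0 = P j (2 * pi) /\ Q j 0 = Q j (2 * pi)].
Proof.
have [g gP] := choice svC.
pose P j th := (g th).1 j 0; pose Q j th := (g th).2 j 0.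
have GE th : graph_state m P Q th = g th.
  have [[_ g1 g2] _] := gP th.
  rewrite [RHS]surjective_pairing /graph_state; congr pair; apply/colP => i;
    by rewrite mxE; case: eqP => // ->.
exists P, Q; split => [th|p r th Cp|j].
- by rewrite /= GE; have [[]] := gP th.
- rewrite le_eqVlt => /orP[/eqP <-|r0].
    (* At radius 0 the master pair vanishes, and no multiple of such a state lies on the cylinder,
       so [p] is the vertex. *)
    rewrite !mul0r scale0r => u0 v0; apply: contrapT => p0.
    have [l l0] := cone_meets_cyl Cp p0.
    rewrite /H_cyl /= !mxE u0 v0 !mulr0 expr0n addr0 => /esym/eqP.
    by rewrite oner_eq0.
  move=> u v; rewrite /= GE.
  suff -> : g th = r^-1 *: p by rewrite scalerA divff ?gt_eqF// scale1r.
  have [_] := gP th; apply.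
  have u1 : (r^-1 *: p).1 m 0 = cos th by rewrite mxE u mulKf// gt_eqF.
  have v1 : (r^-1 *: p).2 m 0 = sin th by rewrite mxE v mulKf// gt_eqF.
  split => //; split; first by apply: coneZ; rewrite // invr_gt0.
  by rewrite /H_cyl /= in u1 v1 *; rewrite u1 v1 cos2Dsin2.
- suff gE : g 0 = g (2 * pi) by rewrite /P /Q gE.
  have [_ /(_ (g (2 * pi)))] := gP 0; apply.
  have [[? g1 g2] _] := gP (2 * pi); split => //.
    by rewrite g1 mulrC mulr_natr cos2pi cos0.
  by rewrite g2 mulrC mulr_natr sin2pi sin0.
Qed.

(** The generating solution meets the ray of [p] at some time. If that time is an end point with no
    room on side [e], the other end point is taken, since both lie on one ray. *)
Lemma returning_ray_through p e : C p -> p <> 0 -> e = 1 \/ e = - 1 ->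
  exists (phi : R -> state R N) (T t l : R),
    [/\ is_solution S 0 T phi, forall s, 0 <= s <= T -> C (phi s),
        0 <= t <= T, \forall h \near (0 : R)^'+, 0 <= t + e * h <= T &
        0 < l /\ phi t = l *: p].
Proof.
move=> Cp p0 e1; have [_ _ [phi [T [T0 sol _ [l l0 phiT] CE]]]] := coneC.
have CP s : 0 <= s <= T -> C (phi s).
  move=> sT; rewrite CE; right; exists s; first by rewrite /= in_itv.
  by exists 1; rewrite /= ?ltr01// scale1r.
have [//|[t]] : ([set 0] `|` \bigcup_(t in `[0, T]) ray (phi t)) p by rewrite -CE.
 rewrite /= in_itv /= => /andP[t0 tT] [al al0 alp].
have phit : phi t = al^-1 *: p by rewrite -alp scalerA mulVf ?scale1r// gt_eqF.
have al'0 : 0 < al^-1 by rewrite invr_gt0.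
exists phi, T; case: e1 => ->.
- have [tT'|Tt] := ltP t T.
    exists t, al^-1; split => //; first by rewrite t0 ltW.
    by apply/near_at_right0P; exists (T - t); [lra | move=> h ? ?; lra].
  (* The motion resumes at time 0; [phi T = l *: phi 0] accounts for the factor [l^-1]. *)
  have tE : t = T by apply/eqP; rewrite eq_le tT.
  exists 0, (l^-1 * al^-1); split => //; first by rewrite lexx ltW.
    by apply/near_at_right0P; exists T => // h ? ?; lra.
  split; first by rewrite mulr_gt0// invr_gt0.
  by rewrite -scalerA -phit tE -phiT scalerA mulVf ?scale1r// gt_eqF.
- have [t0'|t0'] := ltP 0 t.
    exists t, al^-1; split => //; first by rewrite t0.
    by apply/near_at_right0P; exists t => // h ? ?; lra.
  have tE : t = 0 by apply/eqP; rewrite eq_le t0 t0'.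
  exists T, (l * al^-1); split => //; first by rewrite lexx ltW.
    by apply/near_at_right0P; exists T => // h ? ?; lra.
  by split; [rewrite mulr_gt0 | rewrite -scalerA -phit tE phiT].
Qed.

Variables (P Q : 'I_N -> R -> R).
Let G := graph_state m P Q.
Hypothesis param : forall p r th, C p -> 0 <= r ->
  p.1 m 0 = r * cos th -> p.2 m 0 = r * sin th -> p = r *: G th.
Hypothesis genG : forall th, generating_set m C (G th).
Hypothesis admS : admissible S.

Section OneSide.
Variables (a b e t : R) (phi : R -> state R N).
Hypotheses (sol : is_solution S a b phi) (solC : forall s, a <= s <= b -> C (phi s)).
Hypotheses (e1 : e = 1 \/ e = - 1) (tab : a <= t <= b)
  (hab : \forall h \near (0 : R)^'+, a <= t + e * h <= b).

Let e0 : e != 0.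
Proof. by case: e1 => ->; rewrite ?oppr_eq0 oner_eq0. Qed.

(** [u] and [v] are separate functions because they stand for the coordinates of [phi] and also for
    those of a solution clamped in time. Homogeneity turns the acceleration at [phi t] into [r t]
    times that at [G (th t)]. *)
Lemma master_sided_derivative (u v r th : R -> R) :
  (forall s, a <= s <= b -> u s = (phi s).1 m 0 /\ v s = (phi s).2 m 0) ->
  (\forall h \near (0 : R)^'+, [/\ 0 < r (t + e * h),
     u (t + e * h) = r (t + e * h) * cos (th (t + e * h)) &
     v (t + e * h) = r (t + e * h) * sin (th (t + e * h))]) ->
  [/\ 0 < r t, u t = r t * cos (th t) & v t = r t * sin (th t)] ->
  th (t + e * h) @[h --> (0 : R)^'+] --> th t ->
  sided_derivative e r t (r t * Rtilde m (side_acc S e) G (th t)) /\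
  sided_derivative e th t (Thetatilde m (side_acc S e) G (th t)).
Proof.
move=> uv pol polt thc; have [r0 ut vt] := polt.
have [uE vE] := uv t tab.
have su : sided_derivative e u t ((phi t).2 m 0).
  have := sol_sided_derivative1 (i := m) sol e1 tab hab.
  apply: sided_derivative_near_eq; last by rewrite uE.
  near=> h; have sab : a <= t + e * h <= b by near: h.
  by have [-> _] := uv _ sab.
have sv : sided_derivative e v t (side_acc S e (phi t) m 0).
  have := sol_sided_derivative2 (i := m) admS sol e1 tab hab.
  apply: sided_derivative_near_eq; last by rewrite vE.
  near=> h; have sab : a <= t + e * h <= b by near: h.
  by have [_ ->] := uv _ sab.
have phiE : phi t = r t *: G (th t).
  by apply: param; [exact: solC | exact: ltW | rewrite -uE | rewrite -vE].
have [] := polar_sided_derivative e0 pol polt thc su sv.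
have -> : side_acc S e (phi t) m 0 = r t * side_acc S e (G (th t)) m 0.
  by rewrite phiE side_accZ// mxE.
rewrite -vE vt /Rtilde /Thetatilde; set f := side_acc S e _ m 0.
have -> : r t * (sin (th t) * cos (th t) + sin (th t) * f) =
  cos (th t) * (r t * sin (th t)) + sin (th t) * (r t * f) by ring.
have -> : (cos (th t) * (r t * f) - sin (th t) * (r t * sin (th t))) / r t =
  - sin (th t) ^+ 2 + cos (th t) * f by field; rewrite gt_eqF.
by [].
Unshelve. all: by end_near. Qed.

(** Along the solution [P j] and [Q j] are the coordinates divided by the radius, and the inversion
    of the angle converts their time derivatives. The angle is built here from the solution so as to
    equal [th0] at [t]. *)
Lemma geometry_sided_derivative (l th0 : R) :
  let Th := Thetatilde m (side_acc S e) G th0 in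
  0 < l -> phi t = l *: G th0 -> Th != 0 ->
  geometry_ode (fun g => sided_derivative (e * Num.sg Th) g) m
    (side_acc S e) P Q th0.
Proof.
move=> Th l0 phit Th0 G0 j jm.
have ab : a <= b by case/andP: tab; exact: le_trans.
(* Frozen outside [[a, b]], the solution stays in [C] for all times and has continuous
   coordinates. *)
pose K s := phi (Num.max a (Num.min b s)).
have KE s : a <= s <= b -> K s = phi s.
  by move=> /andP[as_ sb]; rewrite /K (min_idPr sb) (max_idPr as_).
have KC s : C (K s).
  by apply: solC; rewrite le_max lexx ge_max ab ge_min lexx.
have Kt : K t = l *: G th0 by rewrite KE.
pose u s := (K s).1 m 0; pose v s := (K s).2 m 0.
have uc : continuous u := absolutely_continuous_clamp ab (sol.1 m).1.
have vc : continuous v := absolutely_continuous_clamp ab (sol.1 m).2.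
have ut : u t = l * cos th0 by rewrite /u Kt !mxE eqxx.
have vt : v t = l * sin th0 by rewrite /v Kt !mxE eqxx.
pose U s := cos th0 * u s + sin th0 * v s.
pose V s := cos th0 * v s - sin th0 * u s.
pose rho s := Num.sqrt (u s ^+ 2 + v s ^+ 2).
pose th s := th0 + atan (V s / U s).
have Uc : continuous U.
  by move=> s; apply: cvgD; apply: cvgMr; [exact: uc | exact: vc].
have Vc : continuous V.
  by move=> s; apply: cvgB; apply: cvgMr; [exact: vc | exact: uc].
have Ut : U t = l.
  by rewrite /U ut vt -[RHS]mulr1 -(cos2Dsin2 th0); ring.
have Vt : V t = 0 by rewrite /V ut vt; ring.
have tht : th t = th0 by rewrite /th Vt mul0r atan0 addr0.
have polar s : 0 < U s ->
    [/\ 0 < rho s, u s = rho s * cos (th s) & v s = rho s * sin (th s)].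
  exact: polar_atan.
have rhot : rho t = l.
  rewrite /rho ut vt -[RHS]ger0_norm ?ltW// -sqrtr_sqr; congr Num.sqrt.
  by rewrite -[RHS]mulr1 -(cos2Dsin2 th0); ring.
have thc s : 0 < U s -> {for s, continuous th}.
  move=> Us; apply: cvgD; first exact: cvg_cst.
  apply: (cvg_comp (fun s => V s / U s) atan); last exact: continuous_atan.
  by apply: cvgM; [exact: Vc | apply: cvgV; [rewrite gt_eqF | exact: Uc]].
have tec s : {for s, continuous (fun s => t + e * s)}.
  by apply: cvgD; [exact: cvg_cst | apply: cvgMr; exact: cvg_id].
have te := @cvg_at_right_affine R e t.
have Upos : \forall h \near (0 : R)^'+, 0 < U (t + e * h).
  apply: cvgr_gt; first exact: (cvg_comp _ _ te (Uc t)).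
  by rewrite Ut.
have [th_rho th_th] : sided_derivative e rho t
    (rho t * Rtilde m (side_acc S e) G (th t)) /\
  sided_derivative e th t (Thetatilde m (side_acc S e) G (th t)).
  apply: (@master_sided_derivative u v) => //.
  - by move=> s sab; rewrite /u /v KE.
  - near=> h; apply: polar; near: h; exact: Upos.
  - by apply: polar; rewrite Ut.
  - by apply: (cvg_comp _ th te); apply: thc; rewrite Ut.
have [d d0 dP] : exists2 d, 0 < d & forall h, 0 < h -> h < d ->
    0 < U (t + e * h) /\ a <= t + e * h <= b.
  apply/near_at_right0P; near=> h; split; near: h; [exact: Upos | exact: hab].
have d20 : 0 < d / 2 by lra.
have dP' s : 0 <= s <= d / 2 -> 0 < U (t + e * s) /\ a <= t + e * s <= b.
  move=> /andP[]; rewrite le_eqVlt => /orP[/eqP <- _|s0 sd].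
    by rewrite mulr0 addr0 Ut.
  by apply: dP => //; lra.
have th_cont : {in `[0, d / 2], continuous (fun s => th (t + e * s))}.
  move=> s; rewrite in_itv /= => /dP'[Us _].
  exact: (cvg_comp _ _ (tec s) (thc _ Us)).
rewrite tht in th_th.
(* Quotient rule for [z / rho], the [Rtilde] term coming from the derivative of [rho]; it serves
   both [P j] and [Q j]. *)
have key (z p : R -> R) dz :
    (forall s, 0 < U s -> p (th s) = z s / rho s) ->
    sided_derivative e z t dz ->
    sided_derivative (e * Num.sg Th) p th0
      ((dz / l - Rtilde m (side_acc S e) G th0 * (z t / l)) / Th).
  move=> pz sz; rewrite -tht.
  apply: (sided_derivative_inverse (eta := d / 2)
    (z := fun s => z s * (rho s)^-1)) => //.
  - by move=> s /dP'[Us _]; exact: pz.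
  - have rho0 : rho t != 0 by rewrite rhot gt_eqF.
    have := sided_derivativeM e0 sz (sided_derivativeV e0 rho0 th_rho).
    rewrite tht rhot; congr sided_derivative; field; by rewrite gt_eqF.
have KE1 s : 0 < U s -> K s = rho s *: G (th s).
  by move=> /polar[r0 uE vE]; apply: param => //; exact: ltW.
have nearK : \forall h \near (0 : R)^'+, phi (t + e * h) = K (t + e * h).
  by near=> h; rewrite KE//; near: h.
have G1 x : (G x).1 j 0 = P j x by rewrite mxE (negbTE jm).
have G2 x : (G x).2 j 0 = Q j x by rewrite mxE (negbTE jm).
have sx : sided_derivative e (fun s => (K s).1 j 0) t (l * Q j th0).
  have := sol_sided_derivative1 (i := j) sol e1 tab hab.
  rewrite phit mxE G2; apply: sided_derivative_near_eq; last by rewrite KE.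
  near=> h; have -> : phi (t + e * h) = K (t + e * h) by near: h.
  by [].
have sy : sided_derivative e (fun s => (K s).2 j 0) t (l * side_acc S e (G th0) j 0).
  have := sol_sided_derivative2 (i := j) admS sol e1 tab hab.
  rewrite phit side_accZ// mxE; apply: sided_derivative_near_eq; last by rewrite KE.
  near=> h; have -> : phi (t + e * h) = K (t + e * h) by near: h.
  by [].
have Kt1 : (K t).1 j 0 = l * P j th0 by rewrite Kt mxE G1.
have Kt2 : (K t).2 j 0 = l * Q j th0 by rewrite Kt mxE G2.
have mulKl x : l * x / l = x by rewrite mulrC mulKf// gt_eqF.
split.
- have := key _ (P j) _ _ sx; rewrite /= Kt1 !mulKl; apply.
  move=> s Us; have [r0 _ _] := polar _ Us; rewrite KE1// mxE G1.
  by rewrite mulrC mulKf// gt_eqF.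
- have := key _ (Q j) _ _ sy; rewrite /= Kt2 !mulKl; apply.
  move=> s Us; have [r0 _ _] := polar _ Us; rewrite KE1// mxE G2.
  by rewrite mulrC mulKf// gt_eqF.
Unshelve. all: by end_near. Qed.

End OneSide.

(** On the cylinder [G th] is nonzero, so a piece of the generating solution is available on side
    [e] of its ray. *)
Lemma geometry_ode_sided (e th : R) :
  e = 1 \/ e = - 1 -> Thetatilde m (side_acc S e) G th != 0 ->
  geometry_ode (fun g => sided_derivative
    (e * Num.sg (Thetatilde m (side_acc S e) G th)) g) m (side_acc S e) P Q th.
Proof.
move=> e1 Th0; have [CG HG] := genG th.
have G0 : G th <> 0.
  move=> G0; move: HG; rewrite G0 /H_cyl /= !mxE expr0n addr0 => /esym/eqP.
  by rewrite oner_eq0.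
have [phi [T [t [l [sol solC tT hT [l0 phit]]]]]] := returning_ray_through CG G0 e1.
exact: (geometry_sided_derivative sol solC e1 tT hT l0 phit Th0).
Qed.

End ConeGraph.

(** * Assembly of the parametrization and the equations *)

Unset Implicit Arguments.

Theorem mainTheorem3 (R : realType) (N : nat) (S : mech R N)
    (C : set (state R N)) (m : 'I_N) :
  admissible S ->
  invariant_cone S C ->
  rays_biject_generating_set m C ->
  single_valued_in_angle m C ->
  exists P Q : 'I_N -> R -> R,
    let G := graph_state m P Q in
    (* G(theta) traces the generating set, and (r, theta) |-> r G(theta)
       parametrizes C *)
    [/\ generating_set m C = range G,
        C = [set z.1 *: G z.2 | z in [set z : R * R | 0 <= z.1]] &
        forall (p : state R N) (r theta : R), C p -> 0 <= r ->
          p.1 m 0 = r * cos theta -> p.2 m 0 = r * sin theta ->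
          forall j : 'I_N, j != m ->
            p.1 j 0 = r * P j theta /\ p.2 j 0 = r * Q j theta]
    /\
    (* dynamics of the master pair along every solution on C *)
    (forall (a b : R) (phi : R -> state R N) (r theta : R -> R),
       is_solution S a b phi -> C (phi a) ->
       (forall t, a <= t <= b ->
          [/\ 0 < r t, (phi t).1 m 0 = r t * cos (theta t) &
              (phi t).2 m 0 = r t * sin (theta t)]) ->
       {within `[a, b], continuous theta} ->
       forall t, a < t < b ->
         [/\ phi t = r t *: G (theta t),
             ~ crossing_set S (phi t) ->
               master_ode (@has_derivative R) m (accel S) G r theta t &
             crossing_set S (phi t) ->
               master_ode (@has_left_derivative R) m (acc_free S) G r theta t /\
               master_ode (@has_right_derivative R) m (acc_contact S) G r theta t])
    /\
    (* the ordinary differential equations for P and Q *)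
    (forall theta : R, ~ crossing_set S (G theta) ->
       Thetatilde m (accel S) G theta != 0 ->
       geometry_ode (@has_derivative R) m (accel S) P Q theta)
    /\
    (* where f jumps, the same equations hold one-sidedly: no contact before the
       crossing, contact after it, the sign of theta' giving the side *)
    (forall theta : R, crossing_set S (G theta) ->
       [/\ 0 < Thetatilde m (acc_free S) G theta ->
             geometry_ode (@has_left_derivative R) m (acc_free S) P Q theta,
           Thetatilde m (acc_free S) G theta < 0 ->
             geometry_ode (@has_right_derivative R) m (acc_free S) P Q theta,
           0 < Thetatilde m (acc_contact S) G theta ->
             geometry_ode (@has_right_derivative R) m (acc_contact S) P Q theta &
           Thetatilde m (acc_contact S) G theta < 0 ->
             geometry_ode (@has_left_derivative R) m (acc_contact S) P Q theta])
    /\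
    (forall j : 'I_N, j != m ->
       P j 0 = P j (2 * pi) /\ Q j 0 = Q j (2 * pi)).

Proof.
move=> admS coneC bijC svC.
have [P [Q [genG param per]]] := cone_graph coneC bijC svC.
exists P, Q => /=; set G := graph_state m P Q in genG param *.
have GC th : C (G th) by have [] := genG th.
split.
  split.
  - apply/seteqP; split => [p [Cp Hp]|p [th _ <-]]; last exact: genG.
    have [th [uE vE]] := angle_exists Hp.
    exists th => //; rewrite [RHS](param p 1 th) ?scale1r// ?mul1r//.
  - apply/seteqP; split => [p Cp|p [[r th] /= r0 <-]].
      have [->|p0] := pselect (p = 0).
        by exists (0, 0) => /=; rewrite ?scale0r.
      (* Scaling by [l] puts the state on the cylinder, so its radius is [l^-1]. *)
      have [l l0 Hl] := cone_meets_cyl bijC Cp p0.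
      have [th [uE vE]] := angle_exists Hl.
      have lC : C (l *: p) by exact: (coneZ coneC Cp l0).
      have := param (l *: p) 1 th lC ler01; rewrite !mul1r scale1r.
      move=> /(_ uE vE) lp; exists (l^-1, th) => /=; first by rewrite invr_ge0 ltW.
      by rewrite -lp scalerA mulVf ?scale1r// gt_eqF.
    move: r0; rewrite le_eqVlt => /orP[/eqP <-|r0].
      by rewrite scale0r; exact: (cone0 coneC).
    exact: (coneZ coneC (GC th) r0).
  - move=> p r th Cp r0 uE vE j jm.
    by rewrite (param p r th)//= !mxE (negbTE jm).
split.
  move=> a b phi r th sol Ca pol thc t /andP[at_ tb].
  have ab : a < b by exact: lt_trans at_ tb.
  have tab : a <= t <= b by rewrite !ltW.
  have solC s : a <= s <= b -> C (phi s).
    by have [_ inv _] := coneC; apply: inv (ltW ab) sol Ca s.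
  have [r0 ut vt] := pol t tab.
  have phiE : phi t = r t *: G (th t).
    by apply: param => //; [exact: solC | exact: ltW].
  have thct : {for t, continuous th}.
    have [H _ _] := (continuous_within_itvP th ab).1 thc.
    by apply: H; rewrite in_itv /= at_.
  (* An interior time has room on both sides; the two results are combined below according to the
     position of [phi t]. *)
  have side e : e = 1 \/ e = - 1 ->
      sided_derivative e r t (r t * Rtilde m (side_acc S e) G (th t)) /\
      sided_derivative e th t (Thetatilde m (side_acc S e) G (th t)).
    move=> e1.
    have hab : \forall h \near (0 : R)^'+, a <= t + e * h <= b.
      apply/near_at_right0P; exists (Num.min (t - a) (b - t)).
        by rewrite lt_min !subr_gt0 at_.
      by move=> h h0; rewrite lt_min => /andP[? ?]; case: e1 => ->; lra.
    apply: (master_sided_derivative param admS sol solC e1 tab hab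
      (u := fun s => (phi s).1 m 0) (v := fun s => (phi s).2 m 0)) => //.
      near=> h; apply: pol; near: h; exact: hab.
    exact: (cvg_comp _ th (@cvg_at_right_affine _ e t) thct).
  have [r1 th1] := side 1 (or_introl erefl).
  have [r2 th2] := side (- 1) (or_intror erefl).
  have rr0 : r t != 0 by rewrite gt_eqF.
  split => // [ncr|cr].
    have ncG : ~ crossing_set S (G (th t)).
      by rewrite -(crossing_setZ _ _ r0) -phiE.
    (* Off the crossing set both sides share [accel], so the one-sided derivatives agree. *)
    have E e : Rtilde m (side_acc S e) G (th t) = Rtilde m (accel S) G (th t).
      by rewrite /Rtilde side_acc_noncrossing.
    have E' e : Thetatilde m (side_acc S e) G (th t) = Thetatilde m (accel S) G (th t).
      by rewrite /Thetatilde side_acc_noncrossing.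
    rewrite !E !E' in r1 r2 th1 th2; split; last exact: has_derivative_sided.
    exists (r t * Rtilde m (accel S) G (th t)); first exact: has_derivative_sided.
    by rewrite mulrC mulKf.
  have cG : crossing_set S (G (th t)).
    by rewrite -(crossing_setZ _ _ r0) -phiE.
  have n10 : (0 < -1 :> R) = false by apply/negbTE; rewrite -leNgt; lra.
  rewrite /Rtilde /Thetatilde !side_acc_crossing// ltr01 n10 in r1 r2 th1 th2.
  split; split.
  - exists (r t * Rtilde m (acc_free S) G (th t)); first exact/has_left_derivativeE.
    by rewrite mulrC mulKf.
  - exact/has_left_derivativeE.
  - exists (r t * Rtilde m (acc_contact S) G (th t)).
      by rewrite has_right_derivativeE.
    by rewrite mulrC mulKf.
  - by rewrite has_right_derivativeE.
have geo := geometry_ode_sided coneC param genG admS.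
split.
  move=> th ncr Th0.
  have E e : Rtilde m (side_acc S e) G th = Rtilde m (accel S) G th.
    by rewrite /Rtilde side_acc_noncrossing.
  have E' e : Thetatilde m (side_acc S e) G th = Thetatilde m (accel S) G th.
    by rewrite /Thetatilde side_acc_noncrossing.
  move=> j jm.
  have Th1 : Thetatilde m (side_acc S 1) G th != 0 by rewrite E'.
  have Th2 : Thetatilde m (side_acc S (- 1)) G th != 0 by rewrite E'.
  have [P1 Q1] := geo 1 th (or_introl erefl) Th1 j jm.
  have [P2 Q2] := geo (- 1) th (or_intror erefl) Th2 j jm.
  rewrite !E !E' !side_acc_noncrossing// in P1 Q1 P2 Q2.
  rewrite mul1r mulN1r in P1 Q1 P2 Q2.
  (* A decreasing angle exchanges left and right; in either case both sides are covered. *)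
  have := Th0; rewrite neq_lt => /orP[Thn|Thp].
    rewrite ltr0_sg// opprK in P1 Q1 P2 Q2.
    by split; exact: has_derivative_sided.
  rewrite gtr0_sg// in P1 Q1 P2 Q2.
  by split; exact: has_derivative_sided.
split; last by move=> j _; exact: per.
move=> th cr.
have n10 : (0 < -1 :> R) = false by apply/negbTE; rewrite -leNgt; lra.
have EF : Thetatilde m (side_acc S (- 1)) G th = Thetatilde m (acc_free S) G th.
  by rewrite /Thetatilde side_acc_crossing// n10.
have EC : Thetatilde m (side_acc S 1) G th = Thetatilde m (acc_contact S) G th.
  by rewrite /Thetatilde side_acc_crossing// ltr01.
have RF : Rtilde m (side_acc S (- 1)) G th = Rtilde m (acc_free S) G th.
  by rewrite /Rtilde side_acc_crossing// n10.
have RC : Rtilde m (side_acc S 1) G th = Rtilde m (acc_contact S) G th.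
  by rewrite /Rtilde side_acc_crossing// ltr01.
(* Before the crossing the motion is free, and earlier times give angles on the side opposite to the
   sign of the angular velocity. *)
have free : Thetatilde m (acc_free S) G th != 0 ->
    geometry_ode (fun g => sided_derivative
      (- Num.sg (Thetatilde m (acc_free S) G th)) g) m (acc_free S) P Q th.
  rewrite -EF => Th0 G0 j jm.
  have := geo (- 1) th (or_intror erefl) Th0 j jm.
  by rewrite mulN1r -/G EF RF side_acc_crossing// n10.
(* After the crossing there is contact, and later times give angles on the side of that sign. *)
have cont : Thetatilde m (acc_contact S) G th != 0 ->
    geometry_ode (fun g => sided_derivative
      (Num.sg (Thetatilde m (acc_contact S) G th)) g) m (acc_contact S) P Q th.
  rewrite -EC => Th0 G0 j jm.
  have := geo 1 th (or_introl erefl) Th0 j jm.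
  by rewrite mul1r -/G EC RC side_acc_crossing// ltr01.
split=> Ths G0 j jm.
- have Th0 : Thetatilde m (acc_free S) G th != 0 by rewrite gt_eqF.
  have [] := free Th0 j jm; rewrite gtr0_sg// => ? ?.
  by split; apply/has_left_derivativeE.
- have Th0 : Thetatilde m (acc_free S) G th != 0 by rewrite lt_eqF.
  have [] := free Th0 j jm; rewrite ltr0_sg// opprK => ? ?.
  by split; rewrite has_right_derivativeE.
- have Th0 : Thetatilde m (acc_contact S) G th != 0 by rewrite gt_eqF.
  have [] := cont Th0 j jm; rewrite gtr0_sg// => ? ?.
  by split; rewrite has_right_derivativeE.
- have Th0 : Thetatilde m (acc_contact S) G th != 0 by rewrite lt_eqF.
  have [] := cont Th0 j jm; rewrite ltr0_sg// => ? ?.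
  by split; apply/has_left_derivativeE.
Unshelve. all: by end_near. Qed.
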